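(* Let $(G,H,t,m)$ be a Lie crossed module, let $M$ be an $S$-marked manifold and let $(\theta,\Upsilon)$ be a flat $(G,H)$-$2$-connection doublet on $M$. For any $S$-surface knot $\Xi$ of $M$, the $2$-holonomy $F_{\theta,\Upsilon}(\Xi)\in H$ satisfies $$t(F_{\theta,\Upsilon}(\Xi))=1_G .$$
   Context: Conventions. All manifolds and maps are smooth unless stated otherwise. A curve $\gamma:p_0\to p_1$ of a manifold $M$ is a smooth map $\gamma:\mathbb{R}\to M$ such that, for some $0<\epsilon<1/2$, $\gamma(x)=p_0$ for $x<\epsilon$ and $\gamma(x)=p_1$ for $x>1-\epsilon$. $\iota_p$ is the constant curve at $p$, $\gamma^{-1_\circ}(x)=\gamma(1-x)$, and $(\gamma_2\circ\gamma_1)(x)=\gamma_1(2x)$ for $x\le 1/2$, $=\gamma_2(2x-1)$ for $x\ge 1/2$; multiple compositions are performed starting from the rightmost factors. For curves $\gamma_0,\gamma_1:p_0\to p_1$, a surface $\Sigma:\gamma_0\Rightarrow\gamma_1$ is a smooth map $\Sigma:\mathbb{R}^2\to M$ such that, for some $0<\epsilon<1/2$, $\Sigma(x,y)=p_0$ for $x<\epsilon$, $=p_1$ for $x>1-\epsilon$, $=\gamma_0(x)$ for $y<\epsilon$, $=\gamma_1(x)$ for $y>1-\epsilon$. $\Sigma^{-1_\bullet}(x,y)=\Sigma(x,1-y)$; for $\Sigma_1:\gamma_0\Rightarrow\gamma_1$, $\Sigma_2:\gamma_1\Rightarrow\gamma_2$, $(\Sigma_2\bullet\Sigma_1)(x,y)=\Sigma_1(x,2y)$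 for $y\le1/2$, $=\Sigma_2(x,2y-1)$ for $y\ge 1/2$. Marked surfaces. $C$ is an oriented circle with a distinguished point $p_C$. For a manifold $X$ with a distinguished point $p_X$, a spiky $C$-knot of $X$ is a topological embedding $\zeta:C\to X$ with $\zeta(p_C)=p_X$, smooth on $C\setminus\{p_C\}$, whose jets of every order have finite limits at both ends of $C\setminus\{p_C\}$ and whose first derivative has nonzero limits at both ends. $S$ is an oriented closed connected surface of genus $\ell_S$ with a marking: a point $p_S$ and $2\ell_S$ spiky $C$-knots $\zeta_{Si}$ of $(S,p_S)$, with images pairwise intersecting only at $p_S$, representing the homotopy classes of the standard oriented $a$- and $b$-cycles of $S$; $\xi_{Sr}$ (resp. $\eta_{Sr}$), $r=1,\dots,\ell_S$, denotes the $\zeta_{Si}$ corresponding to the $r$-th $a$-cycle (resp. $b$-cycle). An $S$-marking of $M$ is a point $p_M$ and $2\ell_S$ spiky $C$-knots $\zeta_{Mi}$ of $(M,p_M)$ with images pairwise intersecting only at $p_M$. An $S$-surface knot of the $S$-marked manifold $M$ is a smooth embedding $\Xi:S\to M$ with $\Xi(p_S)=p_M$ and $\Xi\circ\zeta_{Si}=\zeta_{Mi}$ for all $i$. All $S$-markings are assumed admissible, i.e. to have at least one $S$-surface knot. Associated surfaces. Fix a compatible curve $\gamma_C$ of $C$, i.e. a curve $\gamma_C:p_C\to p_C$ such that $I_C=\gamma_C^{-1}(C\setminus\{p_C\})$ is an open interval and $\gamma_C|_{I_C}$ is an orientation preserving diffeomorphism onto $C\setminus\{p_C\}$. Put $\alpha_{Sr}=\xi_{Sr}\circ\gamma_C$,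 $\beta_{Sr}=\eta_{Sr}\circ\gamma_C$ and $\tau_S=\beta_{S\ell_S}{}^{-1_\circ}\circ\alpha_{S\ell_S}{}^{-1_\circ}\circ\beta_{S\ell_S}\circ\alpha_{S\ell_S}\circ\cdots\circ\beta_{S1}{}^{-1_\circ}\circ\alpha_{S1}{}^{-1_\circ}\circ\beta_{S1}\circ\alpha_{S1}$ ($\tau_S=\iota_{p_S}$ if $\ell_S=0$). Fix a compatible surface of $S$ congruent with $\gamma_C$, i.e. a surface $\Sigma_S:\iota_{p_S}\Rightarrow\tau_S$ of $S$ such that, with $S'=S\setminus(\{p_S\}\cup\bigcup_i\zeta_{Si}(C))$, $D_S=\Sigma_S^{-1}(S')$ is an open simply connected domain of $\mathbb{R}^2$ and $\Sigma_S|_{D_S}$ is an orientation preserving diffeomorphism onto $S'$. For an $S$-surface knot $\Xi$ of $M$ put $\Sigma_\Xi=\Xi\circ\Sigma_S:\iota_{p_M}\Rightarrow\tau_M$, where $\tau_M=\Xi\circ\tau_S$ depends only on the $S$-marking. A reference $S$-surface knot $\Xi_M$ of the $S$-marked manifold $M$ is fixed; $\Sigma_M=\Sigma_{\Xi_M}$. The normalized surface of $\Xi$ is $\Sigma^\sharp{}_\Xi=\Sigma_M{}^{-1_\bullet}\bullet\Sigma_\Xi:\iota_{p_M}\Rightarrow\iota_{p_M}$. Higher gauge theory. A Lie crossed module $(G,H,t,m)$ consists of Lie groups $G,H$ and Lie group morphisms $t:H\to G$, $m:G\to\mathrm{Aut}(H)$ with $t(m(a)(A))=a\,t(A)a^{-1}$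 and $m(t(A))(B)=ABA^{-1}$. $\mathfrak{g},\mathfrak{h}$ are the Lie algebras, $\dot t:\mathfrak{h}\to\mathfrak{g}$ is the differential of $t$, $\dot m(a):\mathfrak{h}\to\mathfrak{h}$ the differential of $m(a)$ at $1_H$, and $\widehat m(x,X)=\frac{d}{du}\dot m(c(u))(X)|_{u=0}$ for a curve $c$ in $G$ with $c(0)=1_G$, $\dot c(0)=x$ (extended to forms by wedge product). A $(G,H)$-$2$-connection doublet on $M$ is a pair $\theta\in\Omega^1(M,\mathfrak{g})$, $\Upsilon\in\Omega^2(M,\mathfrak{h})$ with $d\theta+\frac12[\theta,\theta]-\dot t(\Upsilon)=0$; it is flat if $d\Upsilon+\widehat m(\theta,\Upsilon)=0$. For a surface $\Sigma$ of $M$, $F_{\theta,\Upsilon}(\Sigma)=E(0,1)\in H$, where $u,v:\mathbb{R}^2\to G$, $E:\mathbb{R}^2\to H$ solve $\partial_xu\,u^{-1}=-\Sigma^*\theta_x$, $u(1,y)=1_G$; $\partial_yv\,v^{-1}=-\Sigma^*\theta_y$, $v(x,0)=1_G$; $\partial_x(\partial_yE\,E^{-1})(x,y)=-\dot m(v(1,y)^{-1}u(x,y)^{-1})(\Sigma^*\Upsilon_{xy}(x,y))$, $E(1,y)=E(x,0)=1_H$. Holonomy. The $2$-holonomy of an $S$-surface knot $\Xi$ is $F_{\theta,\Upsilon}(\Xi)=F_{\theta,\Upsilon}(\Sigma^\sharp{}_\Xi)$. *)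

(* Defs.v *)
From HB Require Import structures.
From mathcomp Require Import all_boot all_order all_algebra.
From mathcomp Require Import all_classical all_reals all_analysis.

Set Implicit Arguments.
Unset Strict Implicit.
Unset Printing Implicit Defensive.

Import Order.TTheory GRing.Theory Num.Theory.
Import numFieldNormedType.Exports.

Local Open Scope classical_set_scope.
Local Open Scope ring_scope.

(** * Smooth manifolds *)

(* The set [U] is meant to be open. *)
Fixpoint Ck_on (R : realType) (V W : normedModType R) (k : nat) (U : set V)
    (f : V -> W) : Prop :=
  (forall x, U x -> {for x, continuous f}) /\
  (if k is k'.+1 then
     forall v, (forall x, U x -> derivable f x v) /\
               Ck_on k' U (fun x => 'D_v f x)
   else True).

Definition smooth_on (R : realType) (V W : normedModType R) (U : set V)
    (f : V -> W) : Prop := forall k, Ck_on k U f.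

(* [cmap] and [cinv] are total functions, whose values outside [cdom] and
   [crange] respectively are irrelevant. *)
Record chart (R : realType) (n : nat) (M : topologicalType) := Chart {
  cdom : set M;
  cmap : M -> 'rV[R]_n;
  cinv : 'rV[R]_n -> M;
  cdom_open : open cdom;
  crange_open : open (cmap @` cdom);
  cmapK : forall p, cdom p -> cinv (cmap p) = p;
  cmap_continuous : forall p, cdom p -> {for p, continuous cmap};
  cinv_continuous : forall x, (cmap @` cdom) x -> {for x, continuous cinv}
}.

Definition crange (R : realType) (n : nat) (M : topologicalType)
  (c : chart R n M) : set 'rV[R]_n := cmap c @` cdom c.

Definition compatible_charts (R : realType) (n : nat) (M : topologicalType)
    (c c' : chart R n M) : Prop :=
  smooth_on (cmap c @` (cdom c `&` cdom c')) (cmap c' \o cinv c) /\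
  smooth_on (cmap c' @` (cdom c `&` cdom c')) (cmap c \o cinv c').

(* A smooth structure is a maximal atlas. *)
HB.mixin Record isManifold (R : realType) (n : nat) M of Topological M := {
  atlas : set (chart R n M);
  atlas_cover : forall p : M, exists c, atlas c /\ cdom c p;
  atlas_compatible : forall c c', atlas c -> atlas c' -> compatible_charts c c';
  atlas_maximal : forall c,
    (forall c', atlas c' -> compatible_charts c c') -> atlas c;
  manifold_hausdorff : hausdorff_space M;
  manifold_second_countable : @second_countable M
}.

#[short(type="manifoldType")]
HB.structure Definition Manifold (R : realType) (n : nat) :=
  {M of Topological M & isManifold R n M}.

Definition chart_at (R : realType) (n : nat) (M : manifoldType R n) (p : M) :
  chart R n M := projT1 (cid (atlas_cover p)).

Definition smooth_into (R : realType) (V : normedModType R) (n : nat)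
    (M : manifoldType R n) (U : set V) (f : V -> M) : Prop :=
  (forall x, U x -> {for x, continuous f}) /\
  (forall c : chart R n M, atlas c ->
    smooth_on (U `&` f @^-1` cdom c) (cmap c \o f)).

Definition smooth_from (R : realType) (V : normedModType R) (n : nat)
    (M : manifoldType R n) (A : set M) (f : M -> V) : Prop :=
  forall c : chart R n M, atlas c ->
    smooth_on (crange c `&` cinv c @^-1` A) (f \o cinv c).

Definition smooth_map (R : realType) (m n : nat) (M : manifoldType R m)
    (N : manifoldType R n) (A : set M) (f : M -> N) : Prop :=
  forall c : chart R m M, atlas c ->
    smooth_into (crange c `&` cinv c @^-1` A) (f \o cinv c).

(* Smoothness of a map out of the product manifold [L * M]. *)
Definition smooth_map2 (R : realType) (l m n : nat) (L : manifoldType R l)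
    (M : manifoldType R m) (N : manifoldType R n) (f : L -> M -> N) : Prop :=
  forall (c : chart R l L) (c' : chart R m M), atlas c -> atlas c' ->
    smooth_into (crange c `*` crange c')
      (fun z : 'rV[R]_l * 'rV[R]_m => f (cinv c z.1) (cinv c' z.2)).

(* The tangent space of [M] at [p] is ['rV[R]_n], a vector being given by its
   components in the chart [chart_at p].  [tangent f z v] is the image in
   T_(f z) M of the vector [v] by the differential of [f] at [z]. *)
Definition tangent (R : realType) (V : normedModType R) (n : nat)
    (M : manifoldType R n) (f : V -> M) (z v : V) : 'rV[R]_n :=
  'D_v (cmap (chart_at (f z)) \o f) z.

Definition differential (R : realType) (m n : nat) (M : manifoldType R m)
    (N : manifoldType R n) (f : M -> N) (p : M) (v : 'rV[R]_m) : 'rV[R]_n :=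
  tangent (f \o cinv (chart_at p)) (cmap (chart_at p) p) v.

Definition topological_embedding (X Y : topologicalType) (f : X -> Y) : Prop :=
  [/\ continuous f, injective f &
      forall U : set X, open U -> exists2 W : set Y, open W & U = f @^-1` W].

Definition smooth_embedding (R : realType) (m n : nat) (M : manifoldType R m)
    (N : manifoldType R n) (f : M -> N) : Prop :=
  [/\ smooth_map setT f, topological_embedding f &
      forall p, injective (differential f p)].

(** * Orientations *)

(* An orientation is an oriented atlas. *)
Definition orientation (R : realType) (n : nat) (M : manifoldType R n)
    (O : set (chart R n M)) : Prop :=
  [/\ O `<=` atlas,
      forall p : M, exists2 c, O c & cdom c p &
      forall c c' p, O c -> O c' -> cdom c p -> cdom c' p ->
        0 < \det (jacobian (cmap c' \o cinv c) (cmap c p))].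

(* The images by the differential of [f] at [z] of the vectors [e i] form a
   positive frame. *)
Definition positive_at (R : realType) (V : normedModType R) (n : nat)
    (M : manifoldType R n) (O : set (chart R n M)) (e : 'I_n -> V)
    (f : V -> M) (z : V) : Prop :=
  forall c, O c -> cdom c (f z) ->
    0 < \det (\matrix_(i < n) 'D_(e i) (cmap c \o f) z).

(* [f] restricts to a diffeomorphism of the open set [D] onto [A], sending the
   frame [e] to positive frames. *)
Definition oriented_diffeo (R : realType) (V : normedModType R) (n : nat)
    (M : manifoldType R n) (O : set (chart R n M)) (e : 'I_n -> V)
    (D : set V) (f : V -> M) (A : set M) : Prop :=
  [/\ smooth_into D f, f @` D = A,
      exists2 g : M -> V, smooth_from A g & forall z, D z -> g (f z) = z &
      forall z, D z -> positive_at O e f z].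

Definition line_frame (R : realType) (i : 'I_1) : R := 1.

Definition ex (R : realType) : R * R := (1, 0).
Definition ey (R : realType) : R * R := (0, 1).
Arguments ex {R}.
Arguments ey {R}.

Definition plane_frame (R : realType) (i : 'I_2) : R * R :=
  if i == ord0 then ex else ey.

(** * Curves and surfaces *)

Definition is_curve (R : realType) (n : nat) (M : manifoldType R n)
    (p0 p1 : M) (g : R -> M) : Prop :=
  smooth_into setT g /\
  exists eps : R, [/\ 0 < eps < 2^-1,
    forall x, x < eps -> g x = p0 & forall x, 1 - eps < x -> g x = p1].

Definition curve_inv (R : realType) (T : Type) (g : R -> T) : R -> T :=
  fun x => g (1 - x).

Definition curve_comp (R : realType) (T : Type) (g2 g1 : R -> T) : R -> T :=
  fun x => if x <= 2^-1 then g1 (2 * x) else g2 (2 * x - 1).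

Definition is_surface (R : realType) (n : nat) (M : manifoldType R n)
    (p0 p1 : M) (g0 g1 : R -> M) (Sig : R * R -> M) : Prop :=
  [/\ is_curve p0 p1 g0, is_curve p0 p1 g1, smooth_into setT Sig &
  exists eps : R, 0 < eps < 2^-1 /\
    [/\ forall x y, x < eps -> Sig (x, y) = p0,
        forall x y, 1 - eps < x -> Sig (x, y) = p1,
        forall x y, y < eps -> Sig (x, y) = g0 x &
        forall x y, 1 - eps < y -> Sig (x, y) = g1 x]].

Definition surface_inv (R : realType) (T : Type) (Sig : R * R -> T) :
  R * R -> T := fun z => Sig (z.1, 1 - z.2).

Definition surface_comp (R : realType) (T : Type) (Sig2 Sig1 : R * R -> T) :
  R * R -> T :=
  fun z => if z.2 <= 2^-1 then Sig1 (z.1, 2 * z.2)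
           else Sig2 (z.1, 2 * z.2 - 1).

(* Composition of the curves of a list, the head being run first and the
   compositions being performed starting from the head. *)
Definition curve_prod (R : realType) (T : Type) (p : T) (s : seq (R -> T)) :
  R -> T :=
  if s is g :: s' then foldl (fun acc h => curve_comp h acc) g s'
  else fun=> p.

(* The indices [inl r] and [inr r] stand for the [r]-th a- and b-cycles. *)
Definition commutator_word (R : realType) (T : Type) (p : T) (l : nat)
    (a : 'I_l + 'I_l -> R -> T) : R -> T :=
  curve_prod p (flatten
    [seq [:: a (inl r); a (inr r); curve_inv (a (inl r)); curve_inv (a (inr r))]
    | r <- enum 'I_l]).

Definition unit_square (R : realType) : set (R * R) := `[0, 1] `*` `[0, 1].

(* Homotopy with fixed end points, inside [A], of paths defined on [0, 1]. *)
Definition path_homotopic (R : realType) (T : topologicalType) (A : set T)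
    (f g : R -> T) : Prop :=
  exists h : R * R -> T,
    [/\ {within @unit_square R, continuous h}, h @` @unit_square R `<=` A,
        forall s, 0 <= s <= 1 -> h (s, 0) = f s /\ h (s, 1) = g s &
        forall u, 0 <= u <= 1 -> h (0, u) = f 0 /\ h (1, u) = f 1].

Definition is_path_in (R : realType) (T : topologicalType) (A : set T)
    (x y : T) (f : R -> T) : Prop :=
  [/\ {within `[0, 1], continuous f}, f @` `[0, 1] `<=` A, f 0 = x & f 1 = y].

Definition simply_connected (R : realType) (T : topologicalType) (A : set T) :
  Prop :=
  [/\ A !=set0,
      forall x y, A x -> A y -> exists f : R -> T, is_path_in A x y f &
      forall x (f : R -> T), is_path_in A x x f ->
        path_homotopic A f (fun=> x)].

(** * Marked surfaces and surface knots *)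

(* [e] identifies R/Z with [C], the origin going to [p]. *)
Definition circle_param (R : realType) (C : manifoldType R 1)
    (OC : set (chart R 1 C)) (p : C) (e : R -> C) : Prop :=
  [/\ smooth_into setT e /\ (forall s, positive_at OC (@line_frame R) e s),
      e 0 = p, range e = setT &
      forall s t, e s = e t <-> exists k : int, s - t = k%:~R].

Definition oriented_circle (R : realType) (C : manifoldType R 1)
    (OC : set (chart R 1 C)) (p : C) : Prop :=
  orientation OC /\ exists e, circle_param OC p e.

(* The knot [z] in the charts at [p] and at [q]. *)
Definition knot_in_charts (R : realType) (C : manifoldType R 1) (n : nat)
    (X : manifoldType R n) (p : C) (q : X) (z : C -> X) : R -> 'rV[R]_n :=
  fun s => cmap (chart_at q) (z (cinv (chart_at p) (const_mx s))).

Definition spiky_knot (R : realType) (C : manifoldType R 1) (n : nat)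
    (X : manifoldType R n) (p : C) (q : X) (z : C -> X) : Prop :=
  let s0 : R := cmap (chart_at p) p ord0 ord0 in
  let f := knot_in_charts p q z in
  [/\ topological_embedding z, z p = q, smooth_map (~` [set p]) z,
      forall k, (exists l : 'rV[R]_n, derive1n k f x @[x --> s0^'-] --> l) /\
                (exists l : 'rV[R]_n, derive1n k f x @[x --> s0^'+] --> l) &
      (exists2 l : 'rV[R]_n, l != 0 & derive1 f x @[x --> s0^'-] --> l) /\
      (exists2 l : 'rV[R]_n, l != 0 & derive1 f x @[x --> s0^'+] --> l)].

Definition meet_only_at (I : eqType) (A T : Type) (q : T) (z : I -> A -> T) :
  Prop := forall i j, i != j -> range (z i) `&` range (z j) = [set q].

(* The standard presentation of the closed oriented surface of genus [l]: [S] is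
   a bouquet of the 2 [l] loops [a i] with a 2-cell [phi] attached along the
   product of the commutators of the loops.  The 2-cell is a square with three
   sides collapsed to [q], which also covers the sphere, where [l] is 0. *)
Definition standard_cycles (R : realType) (S : manifoldType R 2)
    (OS : set (chart R 2 S)) (l : nat) (q : S) (a : 'I_l + 'I_l -> R -> S) :
  Prop :=
  [/\ forall i, is_path_in setT q q (a i),
      forall i s t, 0 <= s < 1 -> 0 <= t < 1 -> a i s = a i t -> s = t,
      forall i j, i != j ->
        (a i @` `[0, 1]) `&` (a j @` `[0, 1]) = [set q] &
  exists phi : R * R -> S,
    [/\ {within @unit_square R, continuous phi},
        forall x y, 0 <= x <= 1 -> 0 <= y <= 1 ->
          [|| x == 0, x == 1 | y == 0] -> phi (x, y) = q,
        forall x, 0 <= x <= 1 -> phi (x, 1) = commutator_word q a x &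
        oriented_diffeo OS (@plane_frame R) (`]0, 1[ `*` `]0, 1[) phi
          (~` ([set q] `|` \bigcup_i (a i @` `[0, 1])))]].

Definition genus (R : realType) (S : manifoldType R 2)
    (OS : set (chart R 2 S)) (l : nat) : Prop :=
  exists (q : S) (a : 'I_l + 'I_l -> R -> S), standard_cycles OS q a.

Definition closed_surface (R : realType) (S : manifoldType R 2)
    (OS : set (chart R 2 S)) (l : nat) : Prop :=
  [/\ orientation OS, compact [set: S], connected [set: S] & genus OS l].

Definition manifold_marking (R : realType) (C : manifoldType R 1) (n : nat)
    (M : manifoldType R n) (pC : C) (l : nat) (pM : M)
    (zM : 'I_l + 'I_l -> C -> M) : Prop :=
  (forall i, spiky_knot pC pM (zM i)) /\ meet_only_at pM zM.

Definition surface_marking (R : realType) (C : manifoldType R 1)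
    (OC : set (chart R 1 C)) (pC : C) (S : manifoldType R 2)
    (OS : set (chart R 2 S)) (l : nat) (pS : S)
    (zS : 'I_l + 'I_l -> C -> S) : Prop :=
  manifold_marking pC pS zS /\
  exists2 a, standard_cycles OS pS a &
    forall i e, circle_param OC pC e -> path_homotopic setT (zS i \o e) (a i).

Definition surface_knot (R : realType) (C : manifoldType R 1)
    (S : manifoldType R 2) (n : nat) (M : manifoldType R n) (l : nat)
    (pS : S) (zS : 'I_l + 'I_l -> C -> S)
    (pM : M) (zM : 'I_l + 'I_l -> C -> M) (Xi : S -> M) : Prop :=
  [/\ smooth_embedding Xi, Xi pS = pM & forall i, Xi \o zS i = zM i].

Definition compatible_curve (R : realType) (C : manifoldType R 1)
    (OC : set (chart R 1 C)) (pC : C) (gC : R -> C) : Prop :=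
  let I := gC @^-1` (~` [set pC]) in
  [/\ is_curve pC pC gC, open I, is_interval I &
      oriented_diffeo OC (@line_frame R) I gC (~` [set pC])].

Definition compatible_surface (R : realType) (C : manifoldType R 1)
    (S : manifoldType R 2) (OS : set (chart R 2 S)) (l : nat) (pS : S)
    (zS : 'I_l + 'I_l -> C -> S) (gC : R -> C) (SigS : R * R -> S) : Prop :=
  let tauS := commutator_word pS (fun i => zS i \o gC) in
  let S' := ~` ([set pS] `|` \bigcup_i range (zS i)) in
  let D := SigS @^-1` S' in
  [/\ is_surface pS pS (fun=> pS) tauS SigS,
      open D, simply_connected R D &
      oriented_diffeo OS (@plane_frame R) D SigS S'].

Definition normalized_surface (R : realType) (S : Type) (M : Type)
    (SigS : R * R -> S) (XiM Xi : S -> M) : R * R -> M :=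
  surface_comp (surface_inv (XiM \o SigS)) (Xi \o SigS).

(** * Lie groups and Lie crossed modules *)

HB.mixin Record isLieGroup (R : realType) (n : nat) G
    of Manifold R n G & Group G := {
  smooth_mulg : smooth_map2 (fun a b : G => (a * b)%g);
  smooth_invg : smooth_map setT (fun a : G => (a^-1)%g)
}.

#[short(type="lieGroupType")]
HB.structure Definition LieGroup (R : realType) (n : nat) :=
  {G of Manifold R n G & Group G & isLieGroup R n G}.

(* The Lie algebra of [G] is the tangent space ['rV[R]_n] at [1]. *)
Definition curve_from_one (R : realType) (n : nat) (G : lieGroupType R n)
    (x : 'rV[R]_n) : R -> G :=
  fun s => cinv (chart_at (1%g : G)) (cmap (chart_at (1%g : G)) 1%g + s *: x).

Definition Ad (R : realType) (n : nat) (G : lieGroupType R n) (a : G)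
    (x : 'rV[R]_n) : 'rV[R]_n :=
  differential (fun b : G => (a * b * a^-1)%g) 1%g x.

Definition lie_bracket (R : realType) (n : nat) (G : lieGroupType R n)
    (x y : 'rV[R]_n) : 'rV[R]_n :=
  derive1 (fun s : R => Ad (curve_from_one G x s) y) 0.

(* For [m], being a Lie group morphism to Aut(H) means being a smooth action on
   [H] by automorphisms. *)
Record lie_crossed_module (R : realType) (nG nH : nat) (G : lieGroupType R nG)
    (H : lieGroupType R nH) (t : H -> G) (m : G -> H -> H) : Prop := {
  lcm_t_smooth : smooth_map setT t;
  lcm_tM : {morph t : A B / (A * B)%g};
  lcm_m_smooth : smooth_map2 m;
  lcm_m_aut : forall a, {morph m a : A B / (A * B)%g};
  lcm_m1 : forall A, m 1%g A = A;
  lcm_mM : forall a b A, m (a * b)%g A = m a (m b A);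
  lcm_equivariance : forall a A, t (m a A) = (a * t A * a^-1)%g;
  lcm_peiffer : forall A B, m (t A) B = (A * B * A^-1)%g
}.

Definition tdot (R : realType) (nG nH : nat) (G : lieGroupType R nG)
    (H : lieGroupType R nH) (t : H -> G) (X : 'rV[R]_nH) : 'rV[R]_nG :=
  differential t 1%g X.

Definition mdot (R : realType) (nG nH : nat) (G : lieGroupType R nG)
    (H : lieGroupType R nH) (m : G -> H -> H) (a : G) (X : 'rV[R]_nH) :
  'rV[R]_nH := differential (m a) 1%g X.

Definition mhat (R : realType) (nG nH : nat) (G : lieGroupType R nG)
    (H : lieGroupType R nH) (m : G -> H -> H) (x : 'rV[R]_nG)
    (X : 'rV[R]_nH) : 'rV[R]_nH :=
  derive1 (fun s : R => mdot m (curve_from_one G x s) X) 0.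

(* The element (d_v f) f^-1 of the Lie algebra at the point [z]. *)
Definition right_log_derivative (R : realType) (n : nat) (G : lieGroupType R n)
    (V : normedModType R) (f : V -> G) (v z : V) : 'rV[R]_n :=
  tangent (fun w => (f w * (f z)^-1)%g) z v.

(** * Differential forms and 2-connection doublets *)

Definition pullback1 (R : realType) (n k : nat) (M : manifoldType R n)
    (V : normedModType R) (f : V -> M) (om : M -> 'rV[R]_n -> 'rV[R]_k)
    (z u : V) : 'rV[R]_k := om (f z) (tangent f z u).

Definition pullback2 (R : realType) (n k : nat) (M : manifoldType R n)
    (V : normedModType R) (f : V -> M)
    (om : M -> 'rV[R]_n -> 'rV[R]_n -> 'rV[R]_k) (z u v : V) : 'rV[R]_k :=
  om (f z) (tangent f z u) (tangent f z v).

Definition is_form1 (R : realType) (n k : nat) (M : manifoldType R n)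
    (om : M -> 'rV[R]_n -> 'rV[R]_k) : Prop :=
  (forall p, linear (om p)) /\
  (forall (c : chart R n M) u, atlas c ->
     smooth_on (crange c) (fun x => pullback1 (cinv c) om x u)).

Definition is_form2 (R : realType) (n k : nat) (M : manifoldType R n)
    (om : M -> 'rV[R]_n -> 'rV[R]_n -> 'rV[R]_k) : Prop :=
  [/\ forall p u, linear (om p u),
      forall p u, linear (fun v => om p v u),
      forall p u, om p u u = 0 &
      forall (c : chart R n M) u v, atlas c ->
        smooth_on (crange c) (fun x => pullback2 (cinv c) om x u v)].

(* Exterior derivatives, computed at [p] in the chart [chart_at p]. *)
Definition ext_der1 (R : realType) (n k : nat) (M : manifoldType R n)
    (om : M -> 'rV[R]_n -> 'rV[R]_k) (p : M) (u v : 'rV[R]_n) : 'rV[R]_k :=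
  let c := chart_at p in
  'D_u (fun x => pullback1 (cinv c) om x v) (cmap c p)
  - 'D_v (fun x => pullback1 (cinv c) om x u) (cmap c p).

Definition ext_der2 (R : realType) (n k : nat) (M : manifoldType R n)
    (om : M -> 'rV[R]_n -> 'rV[R]_n -> 'rV[R]_k) (p : M)
    (u v w : 'rV[R]_n) : 'rV[R]_k :=
  let c := chart_at p in
  'D_u (fun x => pullback2 (cinv c) om x v w) (cmap c p)
  - 'D_v (fun x => pullback2 (cinv c) om x u w) (cmap c p)
  + 'D_w (fun x => pullback2 (cinv c) om x u v) (cmap c p).

Definition bracket_form (R : realType) (nG : nat) (G : lieGroupType R nG)
    (n : nat) (M : Type) (th th' : M -> 'rV[R]_n -> 'rV[R]_nG) (p : M)
    (u v : 'rV[R]_n) : 'rV[R]_nG :=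
  lie_bracket G (th p u) (th' p v) - lie_bracket G (th p v) (th' p u).

Definition mhat_form (R : realType) (nG nH : nat) (G : lieGroupType R nG)
    (H : lieGroupType R nH) (m : G -> H -> H) (n : nat) (M : Type)
    (th : M -> 'rV[R]_n -> 'rV[R]_nG)
    (Ups : M -> 'rV[R]_n -> 'rV[R]_n -> 'rV[R]_nH) (p : M)
    (u v w : 'rV[R]_n) : 'rV[R]_nH :=
  mhat m (th p u) (Ups p v w) - mhat m (th p v) (Ups p u w)
  + mhat m (th p w) (Ups p u v).

Definition connection_doublet (R : realType) (nG nH : nat)
    (G : lieGroupType R nG) (H : lieGroupType R nH) (t : H -> G) (n : nat)
    (M : manifoldType R n) (th : M -> 'rV[R]_n -> 'rV[R]_nG)
    (Ups : M -> 'rV[R]_n -> 'rV[R]_n -> 'rV[R]_nH) : Prop :=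
  [/\ is_form1 th, is_form2 Ups &
      forall p u v,
        ext_der1 th p u v + 2^-1 *: bracket_form G th th p u v
        - tdot t (Ups p u v) = 0].

Definition flat_doublet (R : realType) (nG nH : nat)
    (G : lieGroupType R nG) (H : lieGroupType R nH) (m : G -> H -> H) (n : nat)
    (M : manifoldType R n) (th : M -> 'rV[R]_n -> 'rV[R]_nG)
    (Ups : M -> 'rV[R]_n -> 'rV[R]_n -> 'rV[R]_nH) : Prop :=
  forall p u v w, ext_der2 Ups p u v w + mhat_form m th Ups p u v w = 0.

(** * Surface transport and 2-holonomy *)

(* [h] is the value F_(th, Ups)(Sig).  A relation is used, as for [is_derive]:
   the solution of the equations exists and is unique, but this is a theorem. *)
Definition is_transport (R : realType) (nG nH : nat)
    (G : lieGroupType R nG) (H : lieGroupType R nH) (m : G -> H -> H) (n : nat)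
    (M : manifoldType R n) (th : M -> 'rV[R]_n -> 'rV[R]_nG)
    (Ups : M -> 'rV[R]_n -> 'rV[R]_n -> 'rV[R]_nH) (Sig : R * R -> M)
    (h : H) : Prop :=
  exists (u v : R * R -> G) (E : R * R -> H),
    [/\ [/\ smooth_into setT u, smooth_into setT v & smooth_into setT E],
        (forall z, right_log_derivative u ex z = - pullback1 Sig th z ex) /\
        (forall y, u (1, y) = 1%g),
        (forall z, right_log_derivative v ey z = - pullback1 Sig th z ey) /\
        (forall x, v (x, 0) = 1%g),
        (forall x y : R,
           'D_ex (right_log_derivative E ey) (x, y)
           = - mdot m ((v (1%R, y))^-1 * (u (x, y))^-1)%g
                 (pullback2 Sig Ups (x, y) ex ey)) /\
        (forall x y, E (1, y) = 1%g /\ E (x, 0) = 1%g) &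
        h = E (0, 1)].

Definition is_2holonomy (R : realType) (nG nH : nat)
    (G : lieGroupType R nG) (H : lieGroupType R nH) (m : G -> H -> H) (n : nat)
    (S : Type) (M : manifoldType R n) (th : M -> 'rV[R]_n -> 'rV[R]_nG)
    (Ups : M -> 'rV[R]_n -> 'rV[R]_n -> 'rV[R]_nH) (SigS : R * R -> S)
    (XiM Xi : S -> M) (h : H) : Prop :=
  is_transport m th Ups (normalized_surface SigS XiM Xi) h.

(* Main.v *)
(* Write rho_x, rho_y for the right logarithmic derivatives along the axes, a and
   b for the components of the pullback of theta along the normalized surface and
   w for u^-1.  The identity d_x rho_y(w) = - Ad(w) d_y rho_x(u) and the vanishing
   fake curvature give
     d_x (rho_y(t E) - rho_y(w) + Ad(w) b) = 0.
   The bracketed expression vanishes at x = 1, and so does b on both vertical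
   sides, the surface being constant there: hence rho_y(t E) = rho_y(w) at x = 0,
   that is, u(0, y) t(E(0, y)) does not depend on y.  Since the surface is also
   constant on the horizontal sides, u(0, 0) = u(0, 1) = 1, and t(E(0, 1)) = 1. *)

Require Import Defs.
From HB Require Import structures.
From mathcomp Require Import all_boot all_order all_algebra.
From mathcomp Require Import all_classical all_reals all_analysis.
From mathcomp Require Import ring lra.

Set Implicit Arguments.
Unset Strict Implicit.
Unset Printing Implicit Defensive.

Import Order.TTheory GRing.Theory Num.Theory.
Import numFieldNormedType.Exports.

Local Open Scope classical_set_scope.
Local Open Scope ring_scope.

(** * Directional derivatives and C^k maps *)

Section DirectionalDerivatives.
Context {R : realType}.

(** A tangent vector at p is a row vector read in [chart_at p], a chart that jumps with p, so a
    field of tangent vectors can only be differentiated where its base point stays put. This shapes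
    the proof. Right logarithmic derivatives always sit at 1, and each second-order fact about a
    group comes from a product equal to 1 on two coordinate lines, whose mixed derivatives are
    compared by Schwarz's theorem. For the commutator of two curves this gives the derivative of
    [Ad] and the antisymmetry of the bracket; for a product of four values of u and u^-1 it gives
    the identity relating rho_y(w) to rho_x(u). The cancellation in the d_x derivative is this. As
    v(1, y) = 1, the equation of E and equivariance give -Ad(w)(d_x b - d_y a + [a, b]) for rho_y(t
    E), the argument being the image of the pulled back Upsilon by vanishing fake curvature. As
    rho_x(u) = -a, the term -rho_y(w) gives -Ad(w) d_y a, and Ad(w) b gives Ad(w)(d_x b +
    [a, b]). *)

Lemma is_derive_line (V W : normedModType R) (f : V -> W) (z v : V) (s : R) :
  derivable f (z + s *: v) v ->
  is_derive s 1 (fun r : R => f (z + r *: v)) ('D_v f (z + s *: v)).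
Proof.
have E : (fun h : R => h^-1 *: ((f \o shift (z + s *: v)) (h *: v)
            - f (z + s *: v))) =
         (fun h : R => h^-1 *: (((fun r : R => f (z + r *: v)) \o shift s)
            (h *: (1:R)) - f (z + s *: v))).
  apply/funext => h /=; congr (_ *: (f _ - _)).
  by rewrite [h%:A]mulr1 scalerDl addrCA.
by rewrite /derivable => D; apply: DeriveDef; rewrite /derivable /derive -E.
Qed.

Lemma is_derive_translate (V W : normedModType R) (f : V -> W) (w z v : V) :
  derivable f (z + w) v ->
  is_derive z v (fun x => f (x + w)) ('D_v f (z + w)).
Proof.
have E : (fun h : R => h^-1 *: ((f \o shift (z + w)) (h *: v) - f (z + w))) =
    (fun h : R => h^-1 *: (((fun x => f (x + w)) \o shift z) (h *: v)
      - f (z + w))).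
  by apply/funext => h /=; rewrite addrA.
by rewrite /derivable => D; apply: DeriveDef; rewrite /derivable /derive -E.
Qed.

(** Bounding |s| by |c|, rather than placing s between 0 and c, gives one statement for both signs
    of c and for c = 0. *)
Lemma MVT_line (V : normedModType R) (f : V -> R) (z v : V) (c : R) :
  (forall s : R, `|s| <= `|c| -> derivable f (z + s *: v) v) ->
  exists2 s : R, `|s| <= `|c| & f (z + c *: v) - f z = c * 'D_v f (z + s *: v).
Proof.
move=> df; pose g (s : R) := f (z + s *: v).
have dg (s : R) : `|s| <= `|c| -> is_derive s 1 g ('D_v f (z + s *: v)).
  by move=> sc; exact/is_derive_line/df.
have g0 : g 0 = f z by rewrite /g scale0r addr0.
have cont (a b : R) : (forall s, s \in `[a, b] -> `|s| <= `|c|) ->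
    {within `[a, b], continuous g}.
  move=> ab; apply: derivable_within_continuous => s sab.
  by have [] := dg s (ab s sab).
have [c0|c0|->] := ltgtP c 0; last first.
- by exists 0 => //; rewrite !scale0r addr0 subrr mul0r.
- have H s : s \in `[0, c] -> `|s| <= `|c|.
    by rewrite in_itv /= => /andP[s0 sc]; rewrite ger0_norm// (ger0_norm (ltW c0)).
  have [] := @MVT R g (fun s => 'D_v f (z + s *: v)) 0 c c0.
  + by move=> s sI; apply/dg/H/subset_itv_oo_cc.
  + exact: cont.
  + move=> s sI; rewrite g0 subr0 => E; exists s; first exact/H/subset_itv_oo_cc.
    by rewrite -/(g c) E mulrC.
- have H s : s \in `[c, 0] -> `|s| <= `|c|.
    rewrite in_itv /= => /andP[cs s0].
    by rewrite ler0_norm// (ler0_norm (ltW c0)) lerN2.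
  have [] := @MVT R g (fun s => 'D_v f (z + s *: v)) c 0 c0.
  + by move=> s sI; apply/dg/H/subset_itv_oo_cc.
  + exact: cont.
  + move=> s sI; rewrite g0 sub0r => E; exists s; first exact/H/subset_itv_oo_cc.
    by rewrite -/(g c) -opprB E mulrN opprK mulrC.
Qed.

(** Both iterated derivatives are approximated by the same second-order difference quotient, which
    is symmetric in p and q. *)
Lemma schwarz (V : normedModType R) (U : set V) (f : V -> R) (z p q : V) :
  open U -> Ck_on 2 U f -> U z ->
  'D_q (fun x => 'D_p f x) z = 'D_p (fun x => 'D_q f x) z.
Proof.
move=> oU [_ Cf] Uz.
have second (p' q' : V) (e : R) : 0 < e -> \forall h \near (0:R)^',
    `|'D_q' (fun x => 'D_p' f x) z -
      (h * h)^-1 * (f (z + h *: q' + h *: p') - f (z + h *: q')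
      - f (z + h *: p') + f z)| <= e.
  move=> e0.
  have [_ [_ /(_ q')[dpq [cpq _]]]] := Cf p'.
  have dp := (Cf p').1.
  have : \forall x \near z, U x /\ `|'D_q' (fun x => 'D_p' f x) z -
      'D_q' (fun x => 'D_p' f x) x| <= e.
    near=> x; split.
      by near: x; exact: open_nbhs_nbhs.
    by near: x; move: (cpq z Uz) => /cvgrPdist_le; exact.
  move=> /nbhs_ballP[r /= r0 rB].
  (* For |s| and |u| at most |h|, the displacement s q' + u p' has norm at most K |h|; the summand 1
     keeps K positive when both directions vanish. *)
  pose K := `|p'| + `|q'| + 1.
  have K0 : 0 < K by rewrite ltr_wpDl// addr_ge0.
  have near0 (h s u : R) : `|h| < r / K -> `|s| <= `|h| -> `|u| <= `|h| ->
      ball z r (z + s *: q' + u *: p').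
    move=> hr sh uh; rewrite -ball_normE /ball_/= -addrA opprD addNKr normrN.
    rewrite (le_lt_trans (ler_normD _ _))// !normrZ.
    apply: (@le_lt_trans _ _ (`|h| * K)); last by rewrite -ltr_pdivlMr.
    rewrite /K !mulrDr mulr1 -addrA [leRHS]addrCA.
    apply: lerD; first exact: ler_wpM2r.
    by rewrite (le_trans (ler_wpM2r (normr_ge0 _) uh))// lerDl.
  near=> h.
  have hn0 : h != 0 by near: h; exact: nbhs_dnbhs_neq.
  have hr : `|h| < r / K by near: h; apply: dnbhs0_lt; rewrite divr_gt0.
  have R1 s u : `|s| <= `|h| -> `|u| <= `|h| -> U (z + s *: q' + u *: p').
    by move=> sh uh; have [] := rB _ (near0 h s u hr sh uh).
  have R0 s : `|s| <= `|h| -> U (z + s *: p').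
    by move=> sh; have := R1 0 s; rewrite normr0 scale0r addr0; apply.
  have tr s : `|s| <= `|h| ->
      is_derive (z + s *: p') p' (fun x => f (x + h *: q'))
        ('D_p' f (z + s *: p' + h *: q')).
    by move=> sh; apply/is_derive_translate/dp; rewrite addrAC; exact: R1.
  (* The mean value theorem is applied to the increment of f by h q', in the direction p', and then
     to the derivative along p', in the direction q'. The double increment becomes h^2 times a
     second derivative at a point close to z. *)
  have [|s sh Es] := @MVT_line V (fun x => f (x + h *: q') - f x) z p' h.
    move=> s sh; apply: derivableB; last exact/dp/R0.
    by have [] := tr s sh.
  have [|t th Et] := @MVT_line V (fun x => 'D_p' f x) (z + s *: p') q' h.
    by move=> t th; apply: dpq; rewrite addrAC; exact: R1.
  have E2 : 'D_p' (fun x => f (x + h *: q') - f x) (z + s *: p') =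
      'D_p' f (z + s *: p' + h *: q') - 'D_p' f (z + s *: p').
    have [d1 d2] := tr s sh.
    by rewrite deriveB; [rewrite d2 | exact: d1 | exact/dp/R0].
  rewrite E2 Et in Es.
  have -> : f (z + h *: q' + h *: p') - f (z + h *: q') - f (z + h *: p') + f z
     = h * (h * 'D_q' ('D_p' f) (z + s *: p' + t *: q')).
    rewrite -Es (addrAC z).
    by move: (f _) (f _) (f _) (f z) => A B D E; ring.
  rewrite mulrA mulKf ?mulf_neq0// (addrAC z).
  by have [] := rB _ (near0 h t s hr th sh).
apply/eqP; rewrite -subr_eq0 -normr_eq0; apply/eqP/le_anti; rewrite normr_ge0 andbT.
apply/ler_addgt0Pl => e e0; rewrite addr0.
have e2 : 0 < e / 2 by rewrite divr_gt0.
(* A single nonzero h serves both orders of differentiation; the common quotient is then eliminated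
   by the triangle inequality. *)
have [h [H1 H2]] := @filter_ex _ _ _ _
  (filterI (second p q _ e2) (second q p _ e2)).
rewrite (splitr e); apply: le_trans (lerD H1 H2).
rewrite -[X in _ <= _ + X]normrN; apply: le_trans (ler_normD _ _).
rewrite (addrAC z (h *: p)) -(addrAC (f _)).
move: ('D_q _ _) ('D_p _ _) (_ * _) => A B X.
by have -> : A - B = A - X - (B - X) by ring.
Unshelve. all: by end_near. Qed.

End DirectionalDerivatives.

Section CkFunctions.
Context {R : realType}.
Implicit Types (k : nat).

Lemma open_near_eq (V W : normedModType R) (N : set V) (f g : V -> W) (x : V) :
  open N -> N x -> (forall y, N y -> f y = g y) -> \near x, f x = g x.
Proof.
move=> oN Nx fg; have := open_nbhs_nbhs (conj oN Nx).
by apply: filterS => y; exact: fg.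
Qed.

(** Limits and directional derivatives at a point see only a neighbourhood of it. The comparison map
    may change with the point, as is needed for maps glued from local pieces. *)
Lemma Ck_on_local (V W : normedModType R) k (U : set V) (f : V -> W) :
  (forall x, U x -> exists (N : set V) (g : V -> W),
     [/\ open N, N x, Ck_on k N g & forall y, N y -> f y = g y]) ->
  Ck_on k U f.
Proof.
elim: k U f => [|k IH] U f loc; split => //.
- move=> x Ux; have [N [g [oN Nx [cg _] fg]]] := loc x Ux.
  have E := open_near_eq oN Nx fg.
  rewrite /prop_for /continuous_at (fg x Nx).
  apply: cvg_trans (cg x Nx); apply: near_eq_cvg.
  by apply: filterS E => y E1; rewrite E1.
- move=> x Ux; have [N [g [oN Nx [cg _] fg]]] := loc x Ux.
  have E := open_near_eq oN Nx fg.
  rewrite /prop_for /continuous_at (fg x Nx).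
  apply: cvg_trans (cg x Nx); apply: near_eq_cvg.
  by apply: filterS E => y E1; rewrite E1.
- move=> v; split.
    move=> x Ux; have [N [g [oN Nx [cg /(_ v)[dg _]] fg]]] := loc x Ux.
    apply: (@near_eq_derivable _ _ _ g); last exact: dg.
    by apply: filterS (open_near_eq oN Nx fg) => y E1; rewrite E1.
  apply: IH => x Ux; have [N [g [oN Nx [cg /(_ v)[_ Cg]] fg]]] := loc x Ux.
  exists N, (fun x => 'D_v g x); split=> // y Ny.
  exact: near_eq_derive (open_near_eq oN Ny fg).
Qed.

Lemma Ck_on_eq (V W : normedModType R) k (U : set V) (f g : V -> W) :
  open U -> (forall x, U x -> f x = g x) -> Ck_on k U g -> Ck_on k U f.
Proof. by move=> oU fg Cg; apply: Ck_on_local => x Ux; exists U, g. Qed.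

Lemma Ck_on_sub (V W : normedModType R) k (U U' : set V) (f : V -> W) :
  U' `<=` U -> Ck_on k U f -> Ck_on k U' f.
Proof.
move=> UU; elim: k f => [|k IH] f [cf Cf]; split => //; try by move=> x /UU/cf.
move=> v.
by have [dv Cv] := Cf v; split => [x /UU/dv//|]; exact: IH.
Qed.

Lemma Ck_onW (V W : normedModType R) k (U : set V) (f : V -> W) :
  Ck_on k.+1 U f -> Ck_on k U f.
Proof.
elim: k f => [|k IH] f [cf Cf]; split => // v.
by have [dv Cv] := Cf v; split => //; exact: IH.
Qed.

Lemma Ck_on_cst (V W : normedModType R) k (U : set V) (c : W) :
  Ck_on k U (fun=> c).
Proof.
elim: k c => [|k IH] c; split => //; try by move=> x _; exact: cst_continuous.
move=> v.
split => [x _|]; first exact: derivable_cst.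
have -> : (fun x => 'D_v (fun=> c) x) = fun=> 0 :> W.
  by apply/funext => x; exact: derive_cst.
exact: IH.
Qed.

Lemma is_derive_linear (V W : normedModType R) (f : {linear V -> W}) (x v : V) :
  continuous f -> is_derive x v f (f v).
Proof.
move=> cf; have df := linear_differentiable x cf.
apply: DeriveDef; first exact: diff_derivable.
by rewrite deriveE// diff_lin.
Qed.

Lemma Ck_on_linear (V W : normedModType R) k (U : set V) (f : {linear V -> W}) :
  continuous f -> Ck_on k U f.
Proof.
move=> cf; case: k => [|k]; split => //; try by move=> x _; exact: cf.
move=> v.
split => [x _|]; first by have [] := is_derive_linear x v cf.
have -> : (fun x => 'D_v f x) = fun=> f v.
  by apply/funext => x; have [] := is_derive_linear x v cf.
exact: Ck_on_cst.
Qed.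

Lemma Ck_on_id (V : normedModType R) k (U : set V) : Ck_on k U (@id V).
Proof. apply: (@Ck_on_linear V V k U idfun) => x; exact: cvg_id. Qed.

Lemma Ck_onD (V W : normedModType R) k (U : set V) (f g : V -> W) : open U ->
  Ck_on k U f -> Ck_on k U g -> Ck_on k U (fun x => f x + g x).
Proof.
move=> oU; elim: k f g => [|k IH] f g [cf Cf] [cg Cg]; split => //.
- by move=> x Ux; apply: continuousD; [exact: cf|exact: cg].
- by move=> x Ux; apply: continuousD; [exact: cf|exact: cg].
move=> v; have [df Df] := Cf v; have [dg Dg] := Cg v; split.
  by move=> x Ux; apply: derivableD; [exact: df|exact: dg].
apply: (Ck_on_eq oU _ (IH _ _ Df Dg)) => x Ux.
by rewrite -deriveD; [|exact: df|exact: dg].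
Qed.

Lemma Ck_on_sum (V W : normedModType R) k (U : set V) (I : Type) (s : seq I)
    (f : I -> V -> W) : open U ->
  (forall i, Ck_on k U (f i)) -> Ck_on k U (fun x => \sum_(i <- s) f i x).
Proof.
move=> oU Cf; elim: s => [|i s IH].
  by apply: (Ck_on_eq oU _ (@Ck_on_cst V W k U 0)) => x _; rewrite big_nil.
apply: (Ck_on_eq oU _ (Ck_onD oU (Cf i) IH)) => x _.
by rewrite big_cons.
Qed.

Lemma is_derive_bigsum (V W : normedModType R) (I : Type) (s : seq I)
    (f : I -> V -> W) (l : I -> W) (x v : V) :
  (forall i, is_derive x v (f i) (l i)) ->
  is_derive x v (fun y => \sum_(i <- s) f i y) (\sum_(i <- s) l i).
Proof.
move=> Df; elim: s => [|i s IH].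
  rewrite big_nil (_ : (fun y => _) = cst 0); first exact: is_derive_cst.
  by apply/funext => y; rewrite big_nil.
rewrite big_cons (_ : (fun y => _) = f i + (fun y => \sum_(j <- s) f j y)).
  exact: is_deriveD.
by apply/funext => y; rewrite big_cons.
Qed.

(** Derivability is assumed along v only, so neither factor need be continuous at x. Splitting the
    increment requires the continuity of [a] along the line x + h v alone, which follows from
    one-variable differentiability. *)
Lemma is_derive_scale (V W : normedModType R) (a : V -> R) (f : V -> W)
    (x v : V) : derivable a x v -> derivable f x v ->
  is_derive x v (fun y => a y *: f y) ('D_v a x *: f x + a x *: 'D_v f x).
Proof.
move=> da df.
have L : (fun h : R => h^-1 *: (((fun y => a y *: f y) \o shift x) (h *: v)
      - a x *: f x)) @ 0^' --> 'D_v a x *: f x + a x *: 'D_v f x.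
  have E : (fun h : R => h^-1 *: (((fun y => a y *: f y) \o shift x) (h *: v)
      - a x *: f x)) = (fun h : R => (h^-1 *: (a (h *: v + x) - a x)) *: f x
        + a (h *: v + x) *: (h^-1 *: (f (h *: v + x) - f x))).
    apply/funext => h /=; rewrite -scalerA scalerBl.
    rewrite [a (h *: v + x) *: _]scalerA [_ * h^-1]mulrC -scalerA.
    rewrite -scalerDr; congr (_ *: _).
    by rewrite scalerBr [RHS]addrC addrA subrK.
  rewrite E; apply: cvgD; first by apply: cvgZ; [exact: da|exact: cvg_cst].
  apply: cvgZ; last exact: df.
  suff : {for 0, continuous (fun h : R => a (h *: v + x))}.
    by move=> /continuous_withinNx; rewrite scale0r add0r.
  exact/differentiable_continuous/derivable1_diffP/(derivable1P _ _ _).1.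
apply: DeriveDef; first by apply/cvg_ex; exists ('D_v a x *: f x + a x *: 'D_v f x).
exact/cvg_lim.
Qed.

Lemma Ck_on_scale (V W : normedModType R) k (U : set V) (a : V -> R)
    (f : V -> W) : open U ->
  Ck_on k U a -> Ck_on k U f -> Ck_on k U (fun x => a x *: f x).
Proof.
move=> oU; elim: k a f => [|k IH] a f Ca Cf.
  split=> // x Ux; apply: continuousZ; [exact: Ca.1|exact: Cf.1].
split; first by move=> x Ux; apply: continuousZ; [exact: Ca.1|exact: Cf.1].
move=> v; have [da Da] := Ca.2 v; have [df Df] := Cf.2 v; split.
  by move=> x Ux; have [] := is_derive_scale (da _ Ux) (df _ Ux).
have := Ck_onD oU (IH _ _ Da (Ck_onW Cf)) (IH _ _ (Ck_onW Ca) Df).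
apply: (Ck_on_eq oU _) => x Ux.
by have [] := is_derive_scale (da _ Ux) (df _ Ux).
Qed.

Lemma is_derive_pair (V W W' : normedModType R) (f : V -> W) (g : V -> W')
    (x v : V) : derivable f x v -> derivable g x v ->
  is_derive x v (fun y => (f y, g y)) ('D_v f x, 'D_v g x).
Proof.
move=> df dg.
have L : (fun h : R => h^-1 *: (((fun y => (f y, g y)) \o shift x) (h *: v)
      - (f x, g x))) @ 0^' --> ('D_v f x, 'D_v g x).
  by apply: cvg_pair; [exact: df|exact: dg].
apply: DeriveDef; first by apply/cvg_ex; exists ('D_v f x, 'D_v g x).
exact/cvg_lim.
Qed.

Lemma Ck_on_pair (V W W' : normedModType R) k (U : set V) (f : V -> W)
    (g : V -> W') : open U ->
  Ck_on k U f -> Ck_on k U g -> Ck_on k U (fun x => (f x, g x)).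
Proof.
move=> oU; elim: k f g => [|k IH] f g [cf Cf] [cg Cg].
  split=> // x Ux; apply: cvg_pair; [exact: cf|exact: cg].
split; first by move=> x Ux; apply: cvg_pair; [exact: cf|exact: cg].
move=> v; have [df Df] := Cf v; have [dg Dg] := Cg v; split.
  by move=> x Ux; have [] := is_derive_pair (df _ Ux) (dg _ Ux).
apply: (Ck_on_eq oU _ (IH _ _ Df Dg)) => x Ux.
by have [] := is_derive_pair (df _ Ux) (dg _ Ux).
Qed.

End CkFunctions.

(** * Finite-dimensional spaces *)

(* Finite-dimensionality: on such a space C^1 maps, whose directional
   derivatives alone are assumed to be continuous, are differentiable. *)
Record coordinates (R : realType) (V : normedModType R) := Coordinates {
  coord_idx : finType;
  coord_vec : coord_idx -> V;
  coord_fun : coord_idx -> {linear V -> R^o};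
  coord_fun_continuous : forall i, continuous (coord_fun i);
  coord_sum : forall v, v = \sum_i coord_fun i v *: coord_vec i
}.

Section Coordinates.
Context {R : realType}.

Lemma coordinates_real : coordinates R.
Proof.
apply: (@Coordinates R R unit (fun=> 1) (fun=> idfun)) => [_ x|v].
  exact: cvg_id.
by rewrite big_const card_unit /= addr0 [_%:A]mulr1.
Qed.

Lemma coordinates_rV n : coordinates 'rV[R]_n.
Proof.
pose f (i : 'I_n) (v : 'rV[R]_n) : R^o := v 0 i.
have lf i : linear (f i) by move=> a u v; rewrite /f !mxE.
pose fL i : {linear 'rV[R]_n -> R^o} :=
  HB.pack (f i) (GRing.isLinear.Build _ _ _ _ _ (lf i)).
apply: (@Coordinates R 'rV[R]_n 'I_n (fun i => delta_mx 0 i) fL) => [i|v].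
  exact: coord_continuous.
exact: row_sum_delta.
Qed.

Lemma coordinates_prod (V W : normedModType R) :
  coordinates V -> coordinates W -> coordinates (V * W)%type.
Proof.
move=> [I e f cf Ef] [J e' g cg Eg].
pose h (k : I + J) (z : V * W) : R^o :=
  match k with inl i => f i z.1 | inr j => g j z.2 end.
have lh k : linear (h k).
  by case: k => i a u v; rewrite /h /= linearP.
pose hL k : {linear (V * W)%type -> R^o} :=
  HB.pack (h k) (GRing.isLinear.Build _ _ _ _ _ (lh k)).
pose b (k : I + J) : V * W :=
  match k with inl i => (e i, 0) | inr j => (0, e' j) end.
apply: (@Coordinates R (V * W)%type (I + J)%type b hL) => [[i|j]|[v w]].
- by move=> z; apply: continuous_comp; [exact: cvg_fst|exact: cf].
- by move=> z; apply: continuous_comp; [exact: cvg_snd|exact: cg].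
- rewrite big_sumType /= .
  have -> : \sum_i f i v *: (e i, 0 : W) = (\sum_i f i v *: e i, 0).
    elim/big_rec2: _ => // i z1 z2 _ ->.
    by congr pair => /=; rewrite scaler0 addr0.
  have -> : \sum_j g j w *: (0 : V, e' j) = (0, \sum_j g j w *: e' j).
    elim/big_rec2: _ => // j z1 z2 _ ->.
    by congr pair => /=; rewrite scaler0 addr0.
  by rewrite -Ef -Eg; congr pair => /=; rewrite ?addr0 ?add0r.
Qed.

Lemma coord_fun_bound (V : normedModType R) (cV : coordinates V)
    (i : coord_idx cV) :
  exists2 K, 0 < K & forall v, `|coord_fun i v| <= K * `|v|.
Proof.
have [K K0 HK] := linear_lipschitz (@coord_fun_continuous _ _ cV i).
by exists K.
Qed.

Lemma coord_partial_sum_bound (V : normedModType R) (cV : coordinates V)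
    (s : seq (coord_idx cV)) :
  exists2 K, 0 < K & forall v,
    `|\sum_(i <- s) coord_fun i v *: coord_vec i| <= K * `|v|.
Proof.
elim: s => [|i s [K K0 HK]].
  by exists 1 => // h; rewrite big_nil normr0 mul1r.
have [C C0 HC] := coord_fun_bound i.
exists (C * `|coord_vec i| + K) => [|h].
  by rewrite ltr_wpDl// mulr_ge0// ltW.
rewrite big_cons (le_trans (ler_normD _ _))// mulrDl lerD// normrZ mulrAC.
by rewrite ler_wpM2r.
Qed.

(* Telescoping along the coordinate axes, each step being estimated by the mean
   value theorem. *)
Lemma C1_partial_increments (V : normedModType R) (cV : coordinates V)
    (U : set V) (f : V -> R) (x : V) (s : seq (coord_idx cV)) :
  open U -> Ck_on 1 U f -> U x ->
  forall e, 0 < e -> \forall h \near (0 : V),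
    `|f (x + \sum_(i <- s) coord_fun i h *: coord_vec i) - f x
      - \sum_(i <- s) coord_fun i h * 'D_(coord_vec i) f x| <= e * `|h|.
Proof.
move=> oU [_ Cf] Ux; elim: s => [|i s IH] e e0.
  by near=> h; rewrite !big_nil addr0 !subrr normr0 mulr_ge0// ltW.
have [K K0 HK] := coord_partial_sum_bound s.
have [C C0 HC] := coord_fun_bound i.
have [df [cdf _]] := Cf (coord_vec i).
(* The step along the i-th axis has length parameter c with |c| <= C |h|, so an error e / 2 / C on
   the derivative costs e / 2 |h|; the other half is left to the induction hypothesis. *)
have e2 : 0 < e / 2 / C by rewrite !divr_gt0.
have : \forall y \near x, U y /\
    `|'D_(coord_vec i) f x - 'D_(coord_vec i) f y| <= e / 2 / C.
  near=> y; split; first by near: y; exact: open_nbhs_nbhs.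
  by near: y; move: (cdf x Ux) => /cvgrPdist_le; exact.
move=> /nbhs_ballP[r /= r0 rB].
(* L |h| bounds the whole displacement: K |h| for the axes already travelled and C |h| times the
   norm of the i-th vector for the current one. *)
pose L := K + C * `|coord_vec i|.
have L0 : 0 < L by rewrite ltr_pwDl// mulr_ge0// ltW.
have IHe := IH _ (divr_gt0 e0 (ltr0Sn R 1)).
near=> h.
have I1 : `|f (x + \sum_(j <- s) coord_fun j h *: coord_vec j) - f x
      - \sum_(j <- s) coord_fun j h * 'D_(coord_vec j) f x| <= e / 2 * `|h|.
  by near: h.
rewrite !big_cons.
have := HK h; set Sh := \sum_(j <- s) _ *: _ in I1 *; move=> HS.
have := HC h; set c : R := coord_fun i h => Hc.
have hL : `|h| < r / L by near: h; apply: nbhs0_lt; rewrite divr_gt0.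
have inB (t : R) : `|t| <= `|c| -> ball x r (x + Sh + t *: coord_vec i).
  move=> tc; rewrite -ball_normE /ball_/= -addrA opprD addNKr normrN.
  rewrite (le_lt_trans (ler_normD _ _))// normrZ.
  apply: (@le_lt_trans _ _ (`|h| * L)); last by rewrite -ltr_pdivlMr.
  rewrite [leRHS]mulrC /L mulrDl lerD// mulrAC ler_wpM2r//.
  exact: le_trans tc Hc.
have [|t tc Et] := @MVT_line R V f (x + Sh) (coord_vec i) c.
  by move=> t /inB/rB[Ut _]; exact: df.
have [_ Dt] := rB _ (inB t tc).
have I2 : `|c * ('D_(coord_vec i) f (x + Sh + t *: coord_vec i)
             - 'D_(coord_vec i) f x)| <= e / 2 * `|h|.
  rewrite normrM distrC (le_trans (ler_pM _ _ Hc Dt))//.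
  by rewrite mulrAC [C * _]mulrC divfK ?gt_eqF.
have -> : e * `|h| = e / 2 * `|h| + e / 2 * `|h|.
  by rewrite -mulrDl -splitr.
apply: le_trans (lerD I1 I2).
apply: le_trans _ (ler_normD _ _).
have -> : x + (c *: coord_vec i + Sh) = x + Sh + c *: coord_vec i.
  by rewrite (addrC (c *: _)) addrA.
rewrite mulrBr -Et le_eqVlt; apply/orP; left; apply/eqP; congr (`| _ |).
move: (f _) (f _) (f x) (\sum_(j <- s) _) (c * _) => A B D E F.
by ring.
Unshelve. all: by end_near. Qed.

End Coordinates.

(** * Differentiability of C^1 maps and the chain rule *)

Section ChainRule.
Context {R : realType}.

Lemma C1_real_differentiable (V : normedModType R) (cV : coordinates V)
    (U : set V) (f : V -> R) (x : V) :
  open U -> Ck_on 1 U f -> U x -> differentiable f x.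
Proof.
move=> oU Cf Ux.
pose df (h : V) : R^o := \sum_(i : coord_idx cV) coord_fun i h * 'D_(coord_vec i) f x.
have ldf : linear df.
  move=> a u v; rewrite /df scaler_sumr -big_split /=; apply: eq_bigr => i _.
  by rewrite linearP /= mulrDl -scalerAl.
pose dL : {linear V -> R^o} := HB.pack df (GRing.isLinear.Build _ _ _ _ _ ldf).
have cdf : continuous df.
  suff H (s : seq (coord_idx cV)) : continuous (fun h : V =>
      (\sum_(i <- s) coord_fun i h * 'D_(coord_vec i) f x : R)) by exact: H.
  elim: s => [|i s IH] y.
    under eq_fun do rewrite big_nil.
    exact: cst_continuous.
  under eq_fun do rewrite big_cons.
  apply: cvgD; last exact: IH.
  by apply: cvgM; [exact: coord_fun_continuous|exact: cst_continuous].
have E : f \o shift x = cst (f x) + dL +o_ (0 : V) id.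
  apply/eqaddoP => e e0.
  apply: filterS (C1_partial_increments (index_enum (coord_idx cV)) oU Cf Ux e0).
  move=> h; rewrite -coord_sum.
  rewrite [x + h]addrC => H; apply: le_trans H.
  by rewrite !fctE /= opprD addrA.
have D : 'd f x = dL :> (V -> R) by exact: diff_unique.
by apply/diff_locallyP; rewrite D.
Qed.

Lemma is_derive_linear_comp (V W X : normedModType R) (f : V -> W)
    (L : {linear W -> X}) (x v : V) :
  continuous L -> derivable f x v ->
  is_derive x v (fun y => L (f y)) (L ('D_v f x)).
Proof.
move=> cL df.
have Lim : (fun h : R => h^-1 *: (((fun y => L (f y)) \o shift x) (h *: v)
    - L (f x))) @ 0^' --> L ('D_v f x).
  have -> : (fun h : R => h^-1 *: (((fun y => L (f y)) \o shift x) (h *: v)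
      - L (f x))) = L \o (fun h : R => h^-1 *: ((f \o shift x) (h *: v) - f x)).
    apply/funext => h /=; rewrite -raddfB; apply/esym.
    exact: (linearZZ L h^-1 (f (h *: v + x) - f x)).
  by apply: (cvg_comp _ _ df); exact: cL.
apply: DeriveDef; first by apply/cvg_ex; exists (L ('D_v f x)).
exact/cvg_lim.
Qed.

Lemma Ck_on_linear_comp (V W X : normedModType R) k (U : set V) (f : V -> W)
    (L : {linear W -> X}) : open U -> continuous L ->
  Ck_on k U f -> Ck_on k U (fun x => L (f x)).
Proof.
move=> oU cL; elim: k f => [|k IH] f Cf.
  by split=> // x Ux; apply: continuous_comp; [exact: Cf.1|exact: cL].
split=> [x Ux|v]; first by apply: continuous_comp; [exact: Cf.1|exact: cL].
have [df Df] := Cf.2 v; split=> [x Ux|].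
  by have [] := is_derive_linear_comp cL (df _ Ux).
apply: (Ck_on_eq oU _ (IH _ Df)) => x Ux.
by have [] := is_derive_linear_comp cL (df _ Ux).
Qed.

Lemma C1_differentiable (V W : normedModType R) (cV : coordinates V)
    (cW : coordinates W) (U : set V) (f : V -> W) (x : V) :
  open U -> Ck_on 1 U f -> U x -> differentiable f x.
Proof.
move=> oU Cf Ux.
have comp (j : coord_idx cW) : differentiable (fun y => coord_fun j (f y) : R) x.
  apply: (C1_real_differentiable cV oU _ Ux).
  exact: (Ck_on_linear_comp oU (@coord_fun_continuous _ _ cW j)).
have -> : f = fun y => \sum_(j : coord_idx cW) coord_fun j (f y) *: coord_vec j.
  by apply/funext => y; exact: coord_sum.
elim: (index_enum _) => [|j s IH].
  rewrite (_ : (fun y => _) = cst 0); first exact: differentiable_cst.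
  by apply/funext => y; rewrite big_nil.
rewrite (_ : (fun y => _) = (fun y => coord_fun j (f y) *: coord_vec j) +
   (fun y => \sum_(j <- s) coord_fun j (f y) *: coord_vec j)).
  by apply: differentiableD => //; exact: differentiableZl.
by apply/funext => y; rewrite big_cons.
Qed.

Lemma derive_line0 (V W : normedModType R) (f : V -> W) (x v : V) :
  'D_v f x = 'D_1 (fun h : R => f (h *: v + x)) 0.
Proof.
rewrite /derive; set g1 := fun h => h^-1 *: _; set g2 := fun h => h^-1 *: _.
suff -> : g1 = g2 by [].
by rewrite funeqE /g1 /g2 => h /=; rewrite addr0 scale0r add0r [_%:A]mulr1.
Qed.

(** Since f is derivable along v only, it is replaced by its restriction to the line through x, a
    differentiable map of one real variable, to which the chain rule for differentials applies. *)
Lemma is_derive_comp (V W X : normedModType R) (f : V -> W) (g : W -> X)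
    (x v : V) :
  derivable f x v -> differentiable g (f x) ->
  is_derive x v (g \o f) ('D_('D_v f x) g (f x)).
Proof.
move=> /derivable1P/derivable1_diffP.
set phi := fun h : R => f (h *: v + x) => dphi.
have phi0 : phi 0 = f x by rewrite /phi scale0r add0r.
rewrite -phi0 => dg; have dgphi := differentiable_comp dphi dg.
apply: DeriveDef; first exact/(derivable1P (g \o f) x v).2/derivable1_diffP.
rewrite derive_line0 (_ : (fun h => _) = g \o phi)//.
transitivity ('d g (phi 0) ('d phi 0 1)).
  by rewrite deriveE; [rewrite diff_comp|].
rewrite (deriveE _ dg); congr ('d g _ _).
by rewrite derive_line0 -/phi deriveE.
Qed.

(** The derivative of g o f along v is that of g in a direction varying with x, while [Ck_on] speaks
    of fixed directions. Expanding the direction in coordinates turns it into a sum of products, to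
    which the induction hypothesis applies. *)
Lemma Ck_on_comp (V W X : normedModType R) (cW : coordinates W)
    (cX : coordinates X) k (U : set V) (U' : set W) (f : V -> W) (g : W -> X) :
  open U -> open U' -> (forall x, U x -> U' (f x)) ->
  Ck_on k U f -> Ck_on k U' g -> Ck_on k U (g \o f).
Proof.
move=> oU oU' UU'; elim: k f g UU' => [|k IH] f g UU' Cf Cg.
  split => // x Ux; apply: continuous_comp; [exact: Cf.1|exact/Cg.1/UU'].
split => [x Ux|v].
  by apply: continuous_comp; [exact: Cf.1|exact/Cg.1/UU'].
have Cg1 : Ck_on 1 U' g.
  by elim: k {IH Cf} g Cg => [//|k IHk] g Cg; exact/IHk/Ck_onW.
have dg x : U x -> differentiable g (f x).
  by move=> Ux; exact: (C1_differentiable cW cX oU' Cg1 (UU' _ Ux)).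
have [df Df] := Cf.2 v.
have D x (Ux : U x) := is_derive_comp (df x Ux) (dg x Ux).
split => [x Ux|]; first by have [] := D x Ux.
apply: (@Ck_on_eq _ _ _ k U _ (fun x => \sum_(i : coord_idx cW)
    coord_fun i ('D_v f x) *: 'D_(coord_vec i) g (f x)) oU).
  move=> x Ux; have [_ ->] := D x Ux.
  rewrite deriveE; last exact: dg.
  rewrite [in LHS](coord_sum cW ('D_v f x)) linear_sum; apply: eq_bigr => i _.
  by rewrite linearZ /= -deriveE//; exact: dg.
apply: (@Ck_on_sum _ _ _ k U _ _ (fun i x =>
    coord_fun i ('D_v f x) *: 'D_(coord_vec i) g (f x)) oU) => i.
apply: (@Ck_on_scale _ _ _ k U (fun x => coord_fun i ('D_v f x))
    (fun x => 'D_(coord_vec i) g (f x)) oU).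
  exact: (Ck_on_linear_comp oU (@coord_fun_continuous _ _ cW i)).
have [_ Dg] := Cg.2 (coord_vec i).
by apply: (IH f (fun y => 'D_(coord_vec i) g y) UU' _ Dg); exact: Ck_onW.
Qed.

End ChainRule.

(** * Smooth maps of manifolds and tangent vectors *)

Section SmoothManifoldMaps.
Context {R : realType}.

Lemma open_preimage_on (X Y : topologicalType) (U : set X) (f : X -> Y)
    (A : set Y) : open U -> (forall x, U x -> {for x, continuous f}) ->
  open A -> open (U `&` f @^-1` A).
Proof.
move=> oU cf oA; rewrite openE => x [Ux Ax]; apply: filterI.
  exact: open_nbhs_nbhs.
by apply: (cf x Ux); exact: open_nbhs_nbhs.
Qed.

Lemma open_setX (X Y : topologicalType) (A : set X) (B : set Y) :
  open A -> open B -> open (A `*` B).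
Proof.
move=> oA oB; rewrite openE => -[x y] [/= Ax By].
by exists (A, B) => //=; split; exact: open_nbhs_nbhs.
Qed.

Section Charts.
Context {n : nat} {M : manifoldType R n}.
Implicit Types (c : chart R n M).

Lemma chart_at_atlas (p : M) : atlas (chart_at p).
Proof. by rewrite /chart_at; case: cid => c []. Qed.

Lemma chart_at_cdom (p : M) : cdom (chart_at p) p.
Proof. by rewrite /chart_at; case: cid => c []. Qed.

Lemma cdom_cinv c x : crange c x -> cdom c (cinv c x).
Proof. by move=> [p cp <-]; rewrite cmapK. Qed.

Lemma cinvK c x : crange c x -> cmap c (cinv c x) = x.
Proof. by move=> [p cp <-]; rewrite cmapK. Qed.

Lemma crange_cmap c p : cdom c p -> crange c (cmap c p).
Proof. by move=> cp; exists p. Qed.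

Lemma open_crange c : open (crange c). Proof. exact: crange_open. Qed.

Lemma open_crangeI c (A : set M) : open A -> open (crange c `&` cinv c @^-1` A).
Proof.
move=> oA; apply: open_preimage_on => //; first exact: open_crange.
exact: cinv_continuous.
Qed.

Section IntoManifold.
Context {V : normedModType R}.

Lemma smooth_into_open (U : set V) (f : V -> M) (A : set M) :
  open U -> smooth_into U f -> open A -> open (U `&` f @^-1` A).
Proof. by move=> oU [cf _]; exact: open_preimage_on. Qed.

Lemma smooth_into_sub (U U' : set V) (f : V -> M) :
  U' `<=` U -> smooth_into U f -> smooth_into U' f.
Proof.
move=> UU [cf sf]; split => [x /UU/cf//|c ac k].
by apply: Ck_on_sub (sf c ac k) => x [/UU].
Qed.

Lemma smooth_into_local (U : set V) (f : V -> M) :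
  (forall x, U x -> exists (N : set V) (g : V -> M),
     [/\ open N, N x, smooth_into N g & forall y, N y -> f y = g y]) ->
  smooth_into U f.
Proof.
move=> loc; split => [x Ux|c ac k].
  have [N [g [oN Nx [cg _] fg]]] := loc x Ux.
  rewrite /prop_for /continuous_at (fg x Nx).
  apply: cvg_trans (cg x Nx); apply: near_eq_cvg.
  have := open_nbhs_nbhs (conj oN Nx); apply: filterS => y Ny.
  by rewrite fg.
apply: Ck_on_local => x [Ux cx].
have [N [g [oN Nx sg fg]]] := loc x Ux.
exists (N `&` g @^-1` cdom c), (cmap c \o g); split.
- exact/smooth_into_open/cdom_open.
- by split => //=; rewrite -fg.
- exact: sg.2.
- by move=> y [Ny _] /=; rewrite fg.
Qed.

Lemma smooth_into_cst (U : set V) (p : M) : smooth_into U (fun=> p).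
Proof.
split=> [x _|c ac k]; first exact: cst_continuous.
exact: Ck_on_cst.
Qed.

End IntoManifold.

Lemma smooth_into_comp (V W : normedModType R) (cW : coordinates W)
    (U : set V) (U' : set W) (s : V -> W) (f : W -> M) :
  open U -> open U' -> (forall x, U x -> U' (s x)) ->
  smooth_on U s -> smooth_into U' f -> smooth_into U (f \o s).
Proof.
move=> oU oU' UU' ss sf; have cs := (ss 0).1.
split=> [x Ux|c ac k].
  by apply: continuous_comp; [exact: cs|exact/sf.1/UU'].
have oU2 : open (U' `&` f @^-1` cdom c) by exact/smooth_into_open/cdom_open.
apply: (Ck_on_comp cW (coordinates_rV n) (f := s) (g := cmap c \o f) _ oU2).
- rewrite (_ : _ `&` _ = U `&` s @^-1` (U' `&` f @^-1` cdom c)).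
    exact: open_preimage_on.
  apply/seteqP; split => x /= [Ux]; first by split => //; split => //; exact: UU'.
  by case.
- by move=> x [Ux fx]; split => //; exact: UU'.
- by apply: Ck_on_sub (ss k) => x [].
- exact: sf.2.
Qed.

Lemma smooth_cinv c : atlas c -> smooth_into (crange c) (cinv c).
Proof.
move=> ac; split => [x|c' ac' k]; first exact: cinv_continuous.
have [H _] := atlas_compatible _ _ ac ac'.
apply: Ck_on_sub (H k) => x [rx cx] /=.
by exists (cinv c x); [split => //; exact: cdom_cinv|exact: cinvK].
Qed.

End Charts.

Section Composition.
Context {m n : nat} {M : manifoldType R m} {N : manifoldType R n}.

(** Near each point, with c the chart at its image, F o f factors as [F \o cinv c] after
    [cmap c \o f], and both factors have normed domains. *)
Lemma smooth_map_comp (V : normedModType R) (U : set V) (f : V -> M)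
    (F : M -> N) :
  open U -> smooth_into U f -> smooth_map setT F -> smooth_into U (F \o f).
Proof.
move=> oU sf sF; apply: smooth_into_local => x Ux.
pose c := chart_at (f x).
exists (U `&` f @^-1` cdom c), ((F \o cinv c) \o (cmap c \o f)).
have oN : open (U `&` f @^-1` cdom c) by exact/smooth_into_open/cdom_open.
split => //.
- by split => //; exact: chart_at_cdom.
- apply: (smooth_into_comp (coordinates_rV m) (U' := crange c)) => //.
  + exact: open_crange.
  + by move=> y [_ cy]; exact: crange_cmap.
  + exact/sf.2/chart_at_atlas.
  + by apply: smooth_into_sub (sF c (chart_at_atlas _)) => y.
- by move=> y [_ cy] /=; rewrite cmapK.
Qed.

End Composition.

Lemma smooth_map2_comp (V : normedModType R) (l m n : nat)
    (L : manifoldType R l) (M : manifoldType R m) (N : manifoldType R n)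
    (F : L -> M -> N) (U : set V) (f : V -> L) (g : V -> M) :
  open U -> smooth_into U f -> smooth_into U g -> smooth_map2 F ->
  smooth_into U (fun x => F (f x) (g x)).
Proof.
move=> oU sf sg sF; apply: smooth_into_local => x Ux.
pose c := chart_at (f x); pose c' := chart_at (g x).
pose P (z : 'rV[R]_l * 'rV[R]_m) := F (cinv c z.1) (cinv c' z.2).
pose s y := (cmap c (f y), cmap c' (g y)).
pose U1 := U `&` f @^-1` cdom c; pose U2 := U `&` g @^-1` cdom c'.
have oU1 : open U1 by exact/smooth_into_open/cdom_open.
have oU2 : open U2 by exact/smooth_into_open/cdom_open.
have oN := openI oU1 oU2.
exists (U1 `&` U2), (P \o s); split => //.
- by split; split => //; exact: chart_at_cdom.
- apply: (smooth_into_comp (coordinates_prod (coordinates_rV l)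
    (coordinates_rV m)) (U' := crange c `*` crange c')) => //.
  + by apply: open_setX; exact: open_crange.
  + by move=> y [[_ cy] [_ cy']]; split; exact: crange_cmap.
  + move=> k; apply: Ck_on_pair => //.
      by apply: Ck_on_sub (sf.2 _ (chart_at_atlas _) k) => y [].
    by apply: Ck_on_sub (sg.2 _ (chart_at_atlas _) k) => y [].
  + exact: sF (chart_at_atlas _) (chart_at_atlas _).
- by move=> y [[_ cy] [_ cy']]; rewrite /P /= !cmapK.
Qed.

End SmoothManifoldMaps.

Section Tangent.
Context {R : realType}.

(** A directional derivative depends only on the restriction to a line, so the two maps may have
    different domains. This transfers derivatives between the plane and the real line, and between
    maps that agree along one axis only. *)
Lemma is_derive_line_eq (V V' W : normedModType R) (f : V -> W) (g : V' -> W)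
    (z v : V) (z' v' : V') (l : W) :
  (\forall s \near (0 : R), f (s *: v + z) = g (s *: v' + z')) ->
  is_derive z v f l -> is_derive z' v' g l.
Proof.
move=> fg [dfz <-].
pose phi (s : R) := f (s *: v + z); pose psi (s : R) := g (s *: v' + z').
have dphi : derivable phi 0 1 := (derivable1P f z v).1 dfz.
have dpsi : derivable psi 0 1 := near_eq_derivable fg dphi.
apply: DeriveDef; first exact: (derivable1P g z' v').2 dpsi.
rewrite (derive_line0 g) (derive_line0 f); apply/esym.
exact: (@near_eq_derive R R W phi psi 0 1 fg).
Qed.

Lemma derive_line_eq (V V' W : normedModType R) (f : V -> W) (g : V' -> W)
    (z v : V) (z' v' : V') :
  (\forall s \near (0 : R), f (s *: v + z) = g (s *: v' + z')) ->
  'D_v f z = 'D_v' g z'.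
Proof.
move=> fg; rewrite (derive_line0 g) (derive_line0 f).
exact: (@near_eq_derive R R W (fun s => f (s *: v + z)) _ 0 1 fg).
Qed.

Section OneManifold.
Context {n : nat} {M : manifoldType R n}.

Lemma tangent_line_eq (V V' : normedModType R) (f : V -> M) (g : V' -> M)
    (z v : V) (z' v' : V') :
  (\forall s \near (0 : R), f (s *: v + z) = g (s *: v' + z')) ->
  tangent f z v = tangent g z' v'.
Proof.
move=> fg; have := nbhs_singleton fg; rewrite !scale0r !add0r => E0.
rewrite /tangent E0; apply: derive_line_eq.
by apply: filterS fg => s /= ->.
Qed.

Lemma tangent_near_eq (V : normedModType R) (f g : V -> M) (z v : V) :
  (\near z, f z = g z) -> tangent f z v = tangent g z v.
Proof.
move=> fg; rewrite /tangent (nbhs_singleton fg); apply: near_eq_derive.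
by apply: filterS fg => y /= ->.
Qed.

Lemma tangent_ext (V : normedModType R) (f g : V -> M) (z v : V) :
  f =1 g -> tangent f z v = tangent g z v.
Proof. by move=> /funext ->. Qed.

Lemma tangent_cst (V : normedModType R) (p : M) (z v : V) :
  tangent (fun=> p) z v = 0.
Proof. exact: derive_cst. Qed.

Lemma smooth_into_chart (V : normedModType R) (U : set V) (f : V -> M) (z : V) :
  open U -> smooth_into U f -> U z ->
  exists N : set V, [/\ open N, N z, N `<=` U `&` f @^-1` cdom (chart_at (f z)) &
    smooth_on N (cmap (chart_at (f z)) \o f)].
Proof.
move=> oU sf Uz; exists (U `&` f @^-1` cdom (chart_at (f z))); split => //.
- exact/smooth_into_open/cdom_open.
- by split => //; exact: chart_at_cdom.
- exact/sf.2/chart_at_atlas.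
Qed.

Lemma smooth_into_differentiable (V : normedModType R) (cV : coordinates V)
    (U : set V) (f : V -> M) (z : V) : open U -> smooth_into U f -> U z ->
  differentiable (cmap (chart_at (f z)) \o f) z.
Proof.
move=> oU sf Uz; have [N [oN Nz _ sN]] := smooth_into_chart oU sf Uz.
exact: (C1_differentiable cV (coordinates_rV n) oN (sN 1)).
Qed.

Lemma tangent_comp (V W : normedModType R) (cW : coordinates W) (U : set W)
    (f : W -> M) (s : V -> W) (z v : V) :
  open U -> smooth_into U f -> U (s z) -> derivable s z v ->
  tangent (f \o s) z v = tangent f (s z) ('D_v s z).
Proof.
move=> oU sf Us ds; rewrite /tangent /=.
have := is_derive_comp ds (smooth_into_differentiable cW oU sf Us).
by move=> [_ <-].
Qed.

Lemma tangent_linear (V : normedModType R) (cV : coordinates V) (U : set V)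
    (f : V -> M) (z : V) : open U -> smooth_into U f -> U z ->
  exists2 L : {linear V -> 'rV[R]_n}, continuous L & tangent f z =1 L.
Proof.
move=> oU sf Uz; have df := smooth_into_differentiable cV oU sf Uz.
exists ('d (cmap (chart_at (f z)) \o f) z).
  by have [] := (diff_locallyP _ _).1 df.
by move=> v; rewrite /tangent deriveE.
Qed.

End OneManifold.

Lemma tangent_smooth_map (V : normedModType R) (m n : nat)
    (M : manifoldType R m) (N : manifoldType R n) (F : M -> N) (U : set V)
    (f : V -> M) (z v : V) :
  smooth_map setT F -> open U -> smooth_into U f -> U z ->
  tangent (F \o f) z v = differential F (f z) (tangent f z v).
Proof.
move=> sF oU sf Uz; have [N' [oN Nz NU sN]] := smooth_into_chart oU sf Uz.
set c := chart_at (f z) in NU sN *.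
have cz : cdom c (f z) by exact: chart_at_cdom.
rewrite (@tangent_near_eq _ _ _ _ ((F \o cinv c) \o (cmap c \o f))).
  rewrite (tangent_comp (coordinates_rV m) (U := crange c))//.
  - exact: open_crange.
  - by apply: smooth_into_sub (sF c (chart_at_atlas _)) => y.
  - exact: crange_cmap.
  - exact: ((sN 1).2 v).1.
have := open_nbhs_nbhs (conj oN Nz); apply: filterS => y /NU[_ cy].
by rewrite /= cmapK.
Qed.

Lemma differential_linear (m n : nat) (M : manifoldType R m)
    (N : manifoldType R n) (F : M -> N) (p : M) : smooth_map setT F ->
  exists2 L : {linear 'rV[R]_m -> 'rV[R]_n},
    continuous L & differential F p =1 L.
Proof.
move=> sF; rewrite /differential.
apply: (tangent_linear (coordinates_rV m) (U := crange (chart_at p))).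
- exact: open_crange.
- by apply: smooth_into_sub (sF _ (chart_at_atlas p)) => y.
- exact/crange_cmap/chart_at_cdom.
Qed.

(** Read in the chart at p, the inverse chart is the identity. Every vector is thus the tangent
    vector of an explicit map, and identities between vectors reduce to maps agreeing along a
    line. *)
Lemma tangent_cinv (n : nat) (M : manifoldType R n) (p : M) (v : 'rV[R]_n) :
  tangent (cinv (chart_at p)) (cmap (chart_at p) p) v = v.
Proof.
have cp := chart_at_cdom p.
rewrite /tangent cmapK// -[RHS](derive_id (cmap (chart_at p) p) v).
apply: near_eq_derive.
have := open_nbhs_nbhs (conj (@open_crange _ _ _ (chart_at p)) (crange_cmap cp)).
by apply: filterS => x rx /=; exact: cinvK.
Qed.

Lemma schwarz_rV (V : normedModType R) (n : nat) (U : set V) (f : V -> 'rV[R]_n)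
    (z p q : V) : open U -> Ck_on 2 U f -> U z ->
  'D_q (fun x => 'D_p f x) z = 'D_p (fun x => 'D_q f x) z.
Proof.
move=> oU Cf Uz; have [_ C1] := Cf.
have cf (i : coord_idx (@coordinates_rV R n)) := @coord_fun_continuous _ _ _ i.
have comp (i : coord_idx (coordinates_rV n)) :
    Ck_on 2 U (fun x => coord_fun i (f x) : R).
  exact: (Ck_on_linear_comp oU (cf i) Cf).
pose fi (i : coord_idx (coordinates_rV n)) (x : V) : R := coord_fun i (f x).
have E i v x : U x -> 'D_v (fi i) x = coord_fun i ('D_v f x).
  by move=> Ux; have [_ E] := is_derive_linear_comp (cf i) ((C1 v).1 x Ux).
have E2 i v v' : 'D_v' (fun x => 'D_v (fi i) x) z =
    coord_fun i ('D_v' (fun x => 'D_v f x) z).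
  have [_ <-] := is_derive_linear_comp (cf i) (((C1 v).2.2 v').1 z Uz).
  apply: (@near_eq_derive R V R); have := open_nbhs_nbhs (conj oU Uz).
  by apply: filterS => y Uy; exact: E.
transitivity (\sum_i coord_fun i ('D_q (fun x => 'D_p f x) z) *:
    coord_vec (c := coordinates_rV n) i); first exact: coord_sum.
transitivity (\sum_i coord_fun i ('D_p (fun x => 'D_q f x) z) *:
    coord_vec (c := coordinates_rV n) i); last exact/esym/coord_sum.
apply: eq_bigr => i _.
have S := @schwarz R V U (fi i) z p q oU (comp i) Uz.
have T := etrans (esym (E2 i p q)) (etrans S (E2 i q p)).
exact: (congr1 (fun r : R => r *: coord_vec (c := coordinates_rV n) i) T).
Qed.

End Tangent.

(** * Lie groups *)

Section MixedPartials.
Context {R : realType}.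

(** Along both lines F keeps the value F z, so [tangent] uses the single chart at F z there, and is
    a directional derivative of one local expression; Schwarz's theorem applies to the latter.
    Elsewhere the chart could change with the point. *)
Lemma mixed_tangent (V : normedModType R) (n : nat) (M : manifoldType R n)
    (U : set V) (F : V -> M) (z p q : V) :
  open U -> smooth_into U F -> U z ->
  (\forall s \near (0 : R), F (s *: p + z) = F z) ->
  (\forall s \near (0 : R), F (s *: q + z) = F z) ->
  exists l, is_derive z p (fun y => tangent F y q) l /\
            is_derive z q (fun y => tangent F y p) l.
Proof.
move=> oU sF Uz Fp Fq; have [N [oN Nz _ sN]] := smooth_into_chart oU sF Uz.
set psi := _ \o F in sN.
exists ('D_p (fun x => 'D_q psi x) z); split.
- apply: (@is_derive_line_eq _ _ _ _ (fun x => 'D_q psi x) _ z p).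
    by apply: filterS Fp => s Es; rewrite /tangent Es.
  by apply/derivableP; exact: (((sN 2).2 q).2.2 p).1.
- rewrite -(schwarz_rV p q oN (sN 2) Nz).
  apply: (@is_derive_line_eq _ _ _ _ (fun x => 'D_p psi x) _ z q).
    by apply: filterS Fq => s Es; rewrite /tangent Es.
  by apply/derivableP; exact: (((sN 2).2 p).2.2 q).1.
Qed.

End MixedPartials.

Section LieGroups.
Context {R : realType} {n : nat} {G : lieGroupType R n}.
Local Open Scope group_scope.

Section FromNormedSpace.
Context {V : normedModType R}.
Implicit Types (f g : V -> G) (U : set V) (z v : V).

Lemma smooth_intoM U f g : open U -> smooth_into U f -> smooth_into U g ->
  smooth_into U (fun x => f x * g x).
Proof.
by move=> oU sf sg; apply: smooth_map2_comp sf sg _ => //; exact: smooth_mulg.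
Qed.

Lemma smooth_intoV U f : open U -> smooth_into U f ->
  smooth_into U (fun x => (f x)^-1).
Proof. by move=> oU sf; exact: (smooth_map_comp oU sf (@smooth_invg _ _ G)). Qed.

(** The differential of the multiplication at (1, 1) is linear, hence determined by the vectors (X,
    0) and (0, Y), along which the multiplication has one factor equal to 1. *)
Lemma tangentM1 U f g z v : open U -> smooth_into U f -> smooth_into U g ->
  U z -> f z = 1 -> g z = 1 ->
  tangent (fun x => f x * g x) z v = (tangent f z v + tangent g z v)%R.
Proof.
move=> oU sf sg Uz f1 g1.
pose c := chart_at (1 : G); pose o := cmap c 1.
have c1 : cdom c 1 by exact: chart_at_cdom.
have ro : crange c o by exact: crange_cmap.
pose P (w : 'rV[R]_n * 'rV[R]_n) := cinv c w.1 * cinv c w.2.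
pose s x := (cmap c (f x), cmap c (g x)).
have cW := coordinates_prod (coordinates_rV (R := R) n) (coordinates_rV n).
have oW : open (crange c `*` crange c) by apply: open_setX; exact: open_crange.
have sP : smooth_into (crange c `*` crange c) P.
  exact: (@smooth_mulg R n G c c (chart_at_atlas _) (chart_at_atlas _)).
have [N1 [oN1 N1z N1U sN1]] := smooth_into_chart oU sf Uz.
have [N2 [oN2 N2z N2U sN2]] := smooth_into_chart oU sg Uz.
rewrite f1 -/c in N1U sN1; rewrite g1 -/c in N2U sN2.
have ds := is_derive_pair (((sN1 1%N).2 v).1 z N1z) (((sN2 1%N).2 v).1 z N2z).
rewrite (@tangent_near_eq _ _ _ _ _ (P \o s)); last first.
  have := open_nbhs_nbhs (conj (openI oN1 oN2) (conj N1z N2z)).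
  apply: filterS => x [/N1U[_ /= cf] /N2U[_ /= cg]].
  by rewrite /P /= !cmapK.
have Es : s z = (o, o) by rewrite /s f1 g1.
rewrite (tangent_comp cW oW sP); last first.
- by have [] := ds.
- by rewrite Es.
have [_ ->] := ds; rewrite Es.
have [L _ EL] := tangent_linear cW oW sP (conj ro ro : (_ `*` _) (o, o)).
have E1 X : tangent P (o, o) (X, 0) = X.
  rewrite -[RHS](tangent_cinv (1 : G) X); apply: tangent_line_eq.
  near=> r; rewrite /P /= scaler0 add0r cmapK//.
  by rewrite mulg1.
have E2 X : tangent P (o, o) (0, X) = X.
  rewrite -[RHS](tangent_cinv (1 : G) X); apply: tangent_line_eq.
  near=> r; rewrite /P /= scaler0 add0r cmapK//.
  by rewrite mul1g.
have Ef : tangent f z v = 'D_v (cmap c \o f) z by rewrite /tangent f1.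
have Eg : tangent g z v = 'D_v (cmap c \o g) z by rewrite /tangent g1.
rewrite Ef Eg -[in RHS](E1 ('D_v _ z)) -[X in _ = (_ + X)%R]E2 !EL -raddfD.
by congr (L _); congr pair; rewrite /= ?addr0 ?add0r.
Unshelve. all: by end_near. Qed.

(** Differentiate the constant product f f^-1. *)
Lemma tangentV1 U f z v : open U -> smooth_into U f -> U z -> f z = 1 ->
  tangent (fun x => (f x)^-1) z v = (- tangent f z v)%R.
Proof.
move=> oU sf Uz f1.
have := tangentM1 v oU sf (smooth_intoV oU sf) Uz f1.
rewrite f1 invg1 => /(_ erefl).
have -> : (fun x => f x * (f x)^-1) = fun=> 1 by apply/funext => x; rewrite mulgV.
by rewrite tangent_cst => /esym/eqP; rewrite addrC addr_eq0 => /eqP.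
Qed.

End FromNormedSpace.

Lemma smooth_conj (a : G) : smooth_map setT (fun b : G => a * b * a^-1).
Proof.
move=> c ac; apply: (@smooth_into_sub _ _ _ _ (crange c)); first by move=> x [].
apply: smooth_intoM; [exact: open_crange| |exact: smooth_into_cst].
apply: smooth_intoM; [exact: open_crange|exact: smooth_into_cst|].
exact: smooth_cinv.
Qed.

Lemma Ad_linear (a : G) :
  exists2 L : {linear 'rV[R]_n -> 'rV[R]_n}, continuous L & Ad a =1 L.
Proof. exact/differential_linear/smooth_conj. Qed.

Lemma tangent_conj (V : normedModType R) (a : G) (U : set V) (f : V -> G) z v :
  open U -> smooth_into U f -> U z -> f z = 1 ->
  tangent (fun x => a * f x * a^-1) z v = Ad a (tangent f z v).
Proof.
move=> oU sf Uz f1.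
by rewrite (tangent_smooth_map v (smooth_conj a) oU sf Uz) f1.
Qed.

Lemma Ad1 (x : 'rV[R]_n) : Ad (1 : G) x = x.
Proof.
rewrite -[RHS](tangent_cinv (1 : G)) /Ad /differential.
by apply: tangent_ext => y /=; rewrite invg1 mulg1 mul1g.
Qed.

Lemma AdM (a b : G) (x : 'rV[R]_n) : Ad (a * b) x = Ad a (Ad b x).
Proof.
pose c := chart_at (1 : G).
have c1 : cdom c 1 by exact: chart_at_cdom.
have sc := smooth_map_comp (@open_crange _ _ _ c)
  (smooth_cinv (chart_at_atlas (1 : G))) (smooth_conj b).
have := tangent_conj a x (@open_crange _ _ _ c) sc (crange_cmap c1).
rewrite /= cmapK// mulg1 mulgV => /(_ erefl) <-.
rewrite /Ad /differential; apply: tangent_ext => y /=.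
by rewrite invgM !mulgA.
Qed.

Section RightLogDerivative.
Context {V : normedModType R}.
Implicit Types (f g : V -> G) (U : set V) (z v : V).

(** With f, g taken at x and f', g' at z, f g (f' g')^-1 = (f f'^-1) (f' (g g'^-1) f'^-1). Both
    factors are 1 at x = z, and the second is a conjugate by a fixed element. *)
Lemma right_log_derivativeM U f g z v :
  open U -> smooth_into U f -> smooth_into U g -> U z ->
  right_log_derivative (fun x => f x * g x) v z =
  (right_log_derivative f v z + Ad (f z) (right_log_derivative g v z))%R.
Proof.
move=> oU sf sg Uz; rewrite /right_log_derivative.
have sr (h : V -> G) : smooth_into U h -> smooth_into U (fun x => h x * (h z)^-1).
  by move=> sh; exact: (smooth_intoM oU sh (smooth_into_cst U (h z)^-1)).
rewrite -(tangent_conj (f z) v oU (sr g sg) Uz) ?mulgV//.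
rewrite -(tangentM1 v oU (sr f sf) _ Uz) ?mulgV ?mulg1 ?mulgV//.
  apply: tangent_ext => x; rewrite invgM !mulgA.
  by rewrite -(mulgA (f x) (f z)^-1) mulVg mulg1.
exact: (smooth_intoM oU (smooth_intoM oU (smooth_into_cst U _) (sr g sg))
  (smooth_into_cst U _)).
Qed.

Lemma right_log_derivative_cst (a : G) z v :
  right_log_derivative (fun=> a) v z = 0%R.
Proof. exact: tangent_cst. Qed.

End RightLogDerivative.
End LieGroups.

(** * The adjoint action and the Lie bracket *)

Section LieBracket.
Context {R : realType} {n : nat} {G : lieGroupType R n}.
Local Open Scope group_scope.

Let openR := @openT R.

(** The line in the chart is controlled only while it stays in the range J of parameters. This is
    why the curves below are smooth on open sets of parameters and not on the whole line. *)
Lemma curve_from_oneP (x : 'rV[R]_n) :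
  let c := chart_at (1%g : G) in
  let J := [set s : R | crange c (cmap c 1%g + s *: x)%R] in
  [/\ open J, smooth_into J (curve_from_one G x), J 0%R,
      curve_from_one G x 0 = 1 & tangent (curve_from_one G x) 0%R 1%R = x].
Proof.
move=> c J; set o := cmap c 1.
have c1 : cdom c 1 by exact: chart_at_cdom.
pose a (s : R) : 'rV[R]_n := (o + s *: x)%R.
have Ca k : Ck_on k [set: R] a.
  apply: Ck_onD => //; first exact: Ck_on_cst.
  by apply: Ck_on_scale => //; [exact: Ck_on_id|exact: Ck_on_cst].
have oJ : open J.
  have := open_preimage_on openR (Ca 0%N).1 (@open_crange _ _ _ c).
  by rewrite setTI.
have J0 : crange c (a 0%R) by rewrite /a scale0r addr0; exact: crange_cmap.
have sc := smooth_cinv (chart_at_atlas (1 : G)).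
have sJ : smooth_into J (curve_from_one G x).
  apply: (smooth_into_comp (coordinates_rV n) oJ (@open_crange _ _ _ c) _ _ sc).
    by [].
  by move=> k; apply: Ck_on_sub (Ca k).
have Da : is_derive (0%R : R) (1%R : R) a x.
  have D := is_derive_scale (@derivable_id R R 0%R 1%R)
    (@derivable_cst R R 'rV[R]_n x 0%R 1%R).
  apply: is_derive_eq (is_deriveD (is_derive_cst o (0%R : R) (1%R : R)) D) _.
  by rewrite derive_id derive_cst scale1r scaler0 addr0 add0r.
split => //; first by rewrite /curve_from_one scale0r addr0 cmapK.
rewrite -[RHS](tangent_cinv (1 : G)).
have [da va] := Da.
rewrite (tangent_comp (coordinates_rV n) (@open_crange _ _ _ c) sc J0 da) va.
by rewrite /a scale0r addr0.
Qed.

(** The commutator F(r, s) = c(r) g(s) c(r)^-1 g(s)^-1 is 1 on both axes. With X and Y the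
    velocities of c and g, its transverse derivatives there are Ad(c(r)) Y - Y and X - Ad(g(s)) X,
    and [mixed_tangent] equates the derivatives of these two at 0. *)
Lemma is_derive_Ad_swap (I J : set R) (c g : R -> G) :
  open I -> open J -> smooth_into I c -> smooth_into J g -> I 0%R -> J 0%R ->
  c 0%R = 1 -> g 0%R = 1 ->
  exists l, is_derive (0%R : R) (1%R : R)
              (fun s => Ad (c s) (tangent g 0%R 1%R)) l /\
            is_derive (0%R : R) (1%R : R)
              (fun s => Ad (g s) (tangent c 0%R 1%R)) (- l)%R.
Proof.
move=> oI oJ sc sg I0 J0 c0 g0.
set X := tangent c 0%R 1%R; set Y := tangent g 0%R 1%R.
pose U : set (R * R) := I `*` J.
have oU : open U by exact: open_setX.
pose F (z : R * R) := c z.1 * g z.2 * (c z.1)^-1 * (g z.2)^-1.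
have s1 : smooth_into U (fun z => c z.1).
  apply: (smooth_into_comp (@coordinates_real R) oU oI _ _ sc); first by move=> z [].
  by move=> k; apply: (@Ck_on_linear _ _ _ k U fst) => z; exact: cvg_fst.
have s2 : smooth_into U (fun z => g z.2).
  apply: (smooth_into_comp (@coordinates_real R) oU oJ _ _ sg); first by move=> z [].
  by move=> k; apply: (@Ck_on_linear _ _ _ k U snd) => z; exact: cvg_snd.
have sF : smooth_into U F.
  exact: (smooth_intoM oU (smooth_intoM oU (smooth_intoM oU s1 s2)
    (smooth_intoV oU s1)) (smooth_intoV oU s2)).
have Eex (s x y : R) : (s *: ex + (x, y) = (s + x, y))%R.
  by congr pair => /=; rewrite ?scaler0 ?add0r// [_ *: _]mulr1.
have Eey (s x y : R) : (s *: ey + (x, y) = (x, s + y))%R.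
  by congr pair => /=; rewrite ?scaler0 ?add0r// [_ *: _]mulr1.
have F00 x : F (x, 0%R) = 1 by rewrite /F /= g0 mulg1 mulgV invg1 mulg1.
have F0y y : F (0%R, y) = 1 by rewrite /F /= c0 mul1g invg1 mulg1 mulgV.
have U0 : U (0%R, 0%R) by [].
have [||l [D1 D2]] := @mixed_tangent R _ n G U F (0%R, 0%R) ex ey oU sF U0.
- by near=> s; rewrite Eex !F00.
- by near=> s; rewrite Eey !F0y.
have T1 (s : R) : tangent F (s, 0%R) ey = (Ad (c s) Y - Y)%R.
  rewrite (@tangent_line_eq _ _ _ _ _ F
    (fun r => c s * g r * (c s)^-1 * (g r)^-1) (s, 0%R) ey 0%R 1%R); last first.
    by near=> r; rewrite Eey /F /= [_ *: 1%R]mulr1.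
  have sgV := smooth_intoV oJ sg.
  have sgc := smooth_intoM oJ (smooth_intoM oJ (smooth_into_cst J (c s)) sg)
    (smooth_into_cst J (c s)^-1).
  rewrite (tangentM1 _ oJ sgc sgV J0) ?g0 ?mulg1 ?mulgV ?invg1//.
  by rewrite (tangent_conj _ _ oJ sg J0 g0) (tangentV1 _ oJ sg J0 g0).
have T2 (s : R) : tangent F (0%R, s) ex = (X - Ad (g s) X)%R.
  rewrite (@tangent_line_eq _ _ _ _ _ F
    (fun r => c r * (g s * (c r)^-1 * (g s)^-1)) (0%R, s) ex 0%R 1%R); last first.
    by near=> r; rewrite Eex /F /= [_ *: 1%R]mulr1 !mulgA.
  have scV := smooth_intoV oI sc.
  have scg := smooth_intoM oI (smooth_intoM oI (smooth_into_cst I (g s)) scV)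
    (smooth_into_cst I (g s)^-1).
  rewrite (tangentM1 _ oI sc scg I0) ?c0 ?invg1 ?mulg1 ?mulgV//.
  rewrite (tangent_conj _ _ oI scV I0) ?c0 ?invg1// (tangentV1 _ oI sc I0 c0).
  by have [L _ EL] := Ad_linear (g s); rewrite !EL raddfN.
exists l; split.
- have D : is_derive (0%R : R) (1%R : R) (fun s => Ad (c s) Y - Y)%R l.
    apply: is_derive_line_eq D1; near=> s.
    by rewrite Eex T1 [_ *: 1%R]mulr1.
  have := is_deriveD D (is_derive_cst Y (0%R : R) (1%R : R)).
  rewrite addr0; congr is_derive.
  by apply/funext => s; rewrite fctE subrK.
- have D : is_derive (0%R : R) (1%R : R) (fun s => X - Ad (g s) X)%R l.
    apply: is_derive_line_eq D2; near=> s.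
    by rewrite Eey T2 [_ *: 1%R]mulr1.
  have := is_deriveB (is_derive_cst X (0%R : R) (1%R : R)) D.
  rewrite sub0r; congr is_derive.
  by apply/funext => s; rewrite !fctE opprB addrC subrK.
Unshelve. all: by end_near. Qed.

(** The bracket is defined with one particular curve of velocity x. By the swap, the derivative of
    Ad(c) y is minus that of Ad(g) x for a fixed curve g of velocity y, and the latter sees c only
    through x; so any curve c gives the same value. *)
Lemma is_derive_Ad (I : set R) (c : R -> G) (y : 'rV[R]_n) :
  open I -> smooth_into I c -> I 0%R -> c 0%R = 1 ->
  is_derive (0%R : R) (1%R : R) (fun s => Ad (c s) y)
    (lie_bracket G (tangent c 0%R 1%R) y).
Proof.
move=> oI sc I0 c0; set x := tangent c 0%R 1%R.
have [oX sX X0 X1 TX] := curve_from_oneP x.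
have [oY sY Y0 Y1 TY] := curve_from_oneP y.
have [l [D1 D2]] := is_derive_Ad_swap oI oY sc sY I0 Y0 c0 Y1.
have [l' [D3 D4]] := is_derive_Ad_swap oX oY sX sY X0 Y0 X1 Y1.
rewrite TY -/x in D1 D2; rewrite TX TY in D3 D4.
have E : l = l'.
  by apply: oppr_inj; have [_ <-] := D2; have [_ <-] := D4.
by rewrite /lie_bracket derive1E; have [_ ->] := D3; rewrite -E.
Qed.

Lemma lie_bracketC (x y : 'rV[R]_n) :
  lie_bracket G x y = (- lie_bracket G y x)%R.
Proof.
have [oX sX X0 X1 TX] := curve_from_oneP x.
have [oY sY Y0 Y1 TY] := curve_from_oneP y.
have [l [D1 D2]] := is_derive_Ad_swap oX oY sX sY X0 Y0 X1 Y1.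
rewrite TX TY in D1 D2; rewrite /lie_bracket !derive1E.
by have [_ ->] := D1; have [_ ->] := D2; rewrite opprK.
Qed.

(** Each Ad(c(s)) is linear, so expanding b(s) in coordinates reduces the claim to the product rule
    for scalar functions times the curves Ad(c(s)) e_i. *)
Lemma is_derive_Ad_comp (I : set R) (c : R -> G) (b : R -> 'rV[R]_n) :
  open I -> smooth_into I c -> I 0%R -> c 0%R = 1 -> derivable b 0%R 1%R ->
  is_derive (0%R : R) (1%R : R) (fun s => Ad (c s) (b s))
    ('D_1%R b 0 + lie_bracket G (tangent c 0%R 1%R) (b 0))%R.
Proof.
move=> oI sc I0 c0 db.
pose K := @coordinates_rV R n; pose e (i : coord_idx K) := coord_vec i.
pose bi (i : coord_idx K) (s : R) : R := coord_fun i (b s).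
have E y s : Ad (c s) y = (\sum_(i : coord_idx K) coord_fun i y *: Ad (c s) (e i))%R.
  have [L _ EL] := Ad_linear (c s).
  rewrite EL {1}(coord_sum K y) raddf_sum; apply: eq_bigr => i _.
  by rewrite EL; exact: linearZZ.
have DA i := is_derive_Ad (e i) oI sc I0 c0.
set X := tangent c 0%R 1%R in DA *.
have Dbi i : is_derive (0%R : R) (1%R : R) (bi i) (coord_fun i ('D_1%R b 0%R)).
  exact: (is_derive_linear_comp (@coord_fun_continuous _ _ K i) db).
(* Linearity of the bracket in its second argument is obtained from that of Ad(c(s)), both sides
   being derivatives of the same curve. *)
have Ebr : lie_bracket G X (b 0%R) =
    (\sum_i coord_fun i (b 0%R) *: lie_bracket G X (e i))%R.
  have [_ <-] := is_derive_Ad (b 0%R) oI sc I0 c0.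
  have := @is_derive_bigsum R R _ _ (index_enum (coord_idx K))
    (fun i s => coord_fun i (b 0%R) *: Ad (c s) (e i))%R
    (fun i => coord_fun i (b 0%R) *: lie_bracket G X (e i))%R 0%R 1%R
    (fun i => is_deriveZ _ (DA i)).
  have -> : (fun s => Ad (c s) (b 0%R)) =
      (fun s => \sum_i coord_fun i (b 0%R) *: Ad (c s) (e i))%R.
    by apply/funext => s; exact: E.
  by case.
have D := @is_derive_bigsum R R _ _ (index_enum (coord_idx K))
  (fun i s => bi i s *: Ad (c s) (e i))%R _ 0%R 1%R
  (fun i => is_derive_scale (@ex_derive _ _ _ _ _ _ _ (Dbi i))
     (@ex_derive _ _ _ _ _ _ _ (DA i))).
rewrite (_ : (fun s => _) = (fun s => \sum_i bi i s *: Ad (c s) (e i))%R); last first.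
  by apply/funext => s; exact: E.
apply: is_derive_eq D _.
rewrite big_split /=; congr (_ + _)%R.
  rewrite [RHS](coord_sum K); apply: eq_bigr => i _.
  by have [_ ->] := Dbi i; rewrite c0 Ad1.
rewrite Ebr; apply: eq_bigr => i _.
by have [_ ->] := DA i.
Qed.

End LieBracket.

(** * Mixed logarithmic derivatives on the plane *)

Section PlaneMaps.
Context {R : realType}.

Lemma line_ex (s x y : R) : s *: ex + (x, y) = (s + x, y).
Proof. by congr pair => /=; rewrite ?scaler0 ?add0r// [_ *: _]mulr1. Qed.

Lemma line_ey (s x y : R) : s *: ey + (x, y) = (x, s + y).
Proof. by congr pair => /=; rewrite ?scaler0 ?add0r// [_ *: _]mulr1. Qed.

Definition coordinates_plane : coordinates (R * R)%type :=
  coordinates_prod coordinates_real coordinates_real.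

Lemma Ck_on_fst k (U : set (R * R)) : Ck_on k U (fun z => z.1).
Proof. by apply: (@Ck_on_linear _ _ _ k U fst) => z; exact: cvg_fst. Qed.

Lemma Ck_on_snd k (U : set (R * R)) : Ck_on k U (fun z => z.2).
Proof. by apply: (@Ck_on_linear _ _ _ k U snd) => z; exact: cvg_snd. Qed.

Section IntoLieGroup.
Context {n : nat} {G : lieGroupType R n}.
Local Open Scope group_scope.

(* The mixed second derivatives at (x, y) of
   u(x', y)^-1 u(x', y') u(x, y')^-1 u(x, y), which is 1 on both coordinate
   lines through (x, y), are computed in the two orders. *)
Lemma right_log_derivative_swap (u : R * R -> G) (x y : R) :
  smooth_into setT u ->
  exists l : 'rV[R]_n,
    is_derive (x, y) ex (right_log_derivative (fun z => (u z)^-1) ey) l /\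
    is_derive (x, y) ey
      (fun z => Ad (u (x, y))^-1 (right_log_derivative u ex z)) (- l)%R.
Proof.
move=> su; have oT := @openT (R * R)%type.
pose z0 := (x, y); pose w (z : R * R) := (u z)^-1.
have sw : smooth_into setT w by exact: smooth_intoV.
have s1 : smooth_into setT (fun z : R * R => w (z.1, y)).
  apply: (smooth_into_comp coordinates_plane oT oT _ _ sw) => // k.
  by apply: Ck_on_pair oT _ _; [exact: Ck_on_fst|exact: Ck_on_cst].
have s2 : smooth_into setT (fun z : R * R => w (x, z.2)).
  apply: (smooth_into_comp coordinates_plane oT oT _ _ sw) => // k.
  by apply: Ck_on_pair oT _ _; [exact: Ck_on_cst|exact: Ck_on_snd].
have scst (a : G) : smooth_into [set: R * R] (fun=> a) by exact: smooth_into_cst.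
pose F (z : R * R) := w (z.1, y) * u z * (w (x, z.2) * u z0).
have sF : smooth_into setT F.
  exact: (smooth_intoM oT (smooth_intoM oT s1 su) (smooth_intoM oT s2 (scst _))).
have uw z : u z * w z = 1 by exact: mulgV.
have wu z : w z * u z = 1 by exact: mulVg.
have Fx x' : F (x', y) = 1 by rewrite /F /= wu mul1g wu.
have Fy y' : F (x, y') = 1.
  by rewrite /F /= mulgA -(mulgA (w (x, y)) (u _)) uw mulg1 wu.
have [||l [D1 D2]] := @mixed_tangent R _ n G setT F z0 ex ey oT sF I.
- by apply: filterE => s; rewrite /z0 line_ex Fx Fx.
- by apply: filterE => s; rewrite /z0 line_ey Fy Fy.
(* At y' = y both halves of F are 1 and their tangent vectors add. The first half is the inverse of
   w w(x', y)^-1; the second contributes a term independent of x'. *)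
have T1 x' : tangent F (x', y) ey = (- right_log_derivative w ey (x', y)
    + right_log_derivative w ey z0)%R.
  have := tangentM1 ey oT (smooth_intoM oT s1 su) (smooth_intoM oT s2 (scst (u z0)))
    (I : setT (x', y)).
  rewrite /= !wu => /(_ erefl erefl) ->.
  have sr := smooth_intoM oT sw (scst (w (x', y))^-1).
  have EV := tangentV1 ey oT sr (I : setT (x', y)) (mulgV _).
  have -> : tangent (fun z => w (z.1, y) * u z) (x', y) ey =
      (- right_log_derivative w ey (x', y))%R.
    rewrite -[RHS]EV; apply: tangent_line_eq; apply: filterE => s.
    by rewrite line_ey /= invgM invgK /w invgK.
  have -> : tangent (fun z => w (x, z.2) * u z0) (x', y) ey =
      right_log_derivative w ey z0.
    apply: tangent_line_eq; apply: filterE => s.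
    by rewrite /z0 !line_ey /w invgK.
  by [].
(* Here F is regrouped as w(., y) w(z0)^-1 times the conjugate by w(z0) of u u(x, y')^-1; both
   factors are 1 at (x, y'). *)
have T2 y' : tangent F (x, y') ex = (right_log_derivative w ex z0
    + Ad (w z0) (right_log_derivative u ex (x, y')))%R.
  have sr := smooth_intoM oT su (scst (u (x, y'))^-1).
  have sr' := smooth_intoM oT s1 (scst (w z0)^-1).
  have sc := smooth_intoM oT (smooth_intoM oT (scst (w z0)) sr)
    (scst (w z0)^-1).
  have EC := tangent_conj (w z0) ex oT sr (I : setT (x, y')) (mulgV _).
  have EM := tangentM1 ex oT sr' sc (I : setT (x, y')) (mulgV _).
  rewrite -[right_log_derivative u ex _]/(tangent _ _ _) -EC.
  have -> : right_log_derivative w ex z0 =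
      tangent (fun z => w (z.1, y) * (w z0)^-1) (x, y') ex.
    by apply: tangent_line_eq; apply: filterE => s; rewrite /z0 !line_ex.
  rewrite -EM; last by rewrite mulgV mulg1 mulgV.
  apply: tangent_line_eq; apply: filterE => s; rewrite line_ex /F /=.
  rewrite !mulgA -(mulgA _ (w z0)^-1) mulVg mulg1.
  by have -> : (w z0)^-1 = u z0 by exact: invgK.
exists (- l)%R; split.
- have D : is_derive z0 ex (fun z => - right_log_derivative w ey z
      + right_log_derivative w ey z0)%R l.
    apply: is_derive_line_eq D1; apply: filterE => s.
    by rewrite /z0 line_ex T1.
  have := is_deriveB (is_derive_cst (right_log_derivative w ey z0) z0 ex) D.
  rewrite sub0r; congr (is_derive _ _ _ _).
  by apply/funext => z; rewrite !fctE opprD opprK addrCA subrr addr0.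
- have D : is_derive z0 ey (fun z => right_log_derivative w ex z0 +
      Ad (w z0) (right_log_derivative u ex z))%R l.
    apply: is_derive_line_eq D2; apply: filterE => s.
    by rewrite /z0 line_ey T2.
  have := is_deriveB D (is_derive_cst (right_log_derivative w ex z0) z0 ey).
  rewrite subr0 opprK; congr (is_derive _ _ _ _).
  by apply/funext => z; rewrite !fctE addrC addKr.
Qed.

End IntoLieGroup.
End PlaneMaps.

(** * Maps with vanishing derivative *)

Section ZeroTangent.
Context {R : realType} {n : nat} {M : manifoldType R n}.

(** [tangent] changes chart from point to point, whereas a mean value argument needs one chart on a
    neighbourhood; the chain rule for the transition map transfers the vanishing. *)
Lemma derive_chart_eq0 (V : normedModType R) (U : set V) (f : V -> M)
    (c : chart R n M) (z v : V) :
  open U -> smooth_into U f -> U z -> atlas c -> cdom c (f z) ->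
  tangent f z v = 0 -> 'D_v (cmap c \o f) z = 0.
Proof.
move=> oU sf Uz ac cz Tz; have [N [oN Nz NU sN]] := smooth_into_chart oU sf Uz.
set c' := chart_at (f z) in NU sN.
have ac' : atlas c' by exact: chart_at_atlas.
have cz' : cdom c' (f z) by exact: chart_at_cdom.
pose B := crange c' `&` cinv c' @^-1` cdom c.
have oB : open B by exact/open_crangeI/cdom_open.
have sT : smooth_on B (cmap c \o cinv c') by case: (smooth_cinv ac') => _; exact.
have Bz : B (cmap c' (f z)).
  by split; [exact: crange_cmap|rewrite /= cmapK].
have dT := C1_differentiable (coordinates_rV n) (coordinates_rV n) oB (sT 1%N) Bz.
have df := ((sN 1%N).2 v).1 z Nz.
rewrite (@near_eq_derive _ _ _ _ ((cmap c \o cinv c') \o (cmap c' \o f))); last first.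
  have := open_nbhs_nbhs (conj oN Nz); apply: filterS => y /NU[_ cy].
  by rewrite /= cmapK.
have [_ ->] := is_derive_comp df dT.
by move: Tz; rewrite /tangent -/c' => ->; rewrite derive0.
Qed.

Lemma tangent_eq0_cst (f : R -> M) (s t : R) : smooth_into setT f ->
  (forall s, tangent f s 1 = 0) -> f s = f t.
Proof.
move=> sf f0.
have loc r : \forall r' \near r, f r' = f r.
  have [N [oN Nr NU sN]] := smooth_into_chart openT sf (I : setT r).
  set c := chart_at (f r) in NU sN.
  have /nbhs_ballP[e /= e0 eN] := open_nbhs_nbhs (conj oN Nr).
  apply/nbhs_ballP; exists e => //= r' rr'.
  have Nr' := eN _ rr'.
  suff E : cmap c (f r') = cmap c (f r).
    by rewrite -(cmapK (NU _ Nr').2) -(cmapK (NU _ Nr).2) E.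
  have cf (i : coord_idx (@coordinates_rV R n)) := @coord_fun_continuous _ _ _ i.
  rewrite [LHS](coord_sum (coordinates_rV n)) [RHS](coord_sum (coordinates_rV n)).
  apply: eq_bigr => i _.
  pose g (q : R) : R := coord_fun i (cmap c (f q)).
  have Dg q : N q -> is_derive q (1 : R) g 0.
    move=> Nq; have [_ cq] := NU q Nq.
    have D := is_derive_linear_comp (cf i) (((sN 1%N).2 1).1 q Nq).
    apply: is_derive_eq D _.
    rewrite (@derive_chart_eq0 R setT f c) ?raddf0//.
      exact: openT.
    exact: chart_at_atlas.
  have inN (q : R) : `|q| <= `|r' - r| -> N (r + q *: 1).
    move=> qr; apply: eN; rewrite -ball_normE /ball_/= [_ *: _]mulr1.
    rewrite opprD addNKr normrN (le_lt_trans qr)//.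
    by move: rr'; rewrite -ball_normE /ball_/= distrC.
  have [|q qr] := @MVT_line R R g r 1 (r' - r).
    by move=> q /inN Nq; have [] := Dg _ Nq.
  have [_ ->] := Dg _ (inN q qr).
  have -> : r + (r' - r) *: 1 = r' by rewrite [_ *: 1]mulr1 addrC subrK.
  rewrite mulr0 => /eqP; rewrite subr_eq0 => /eqP.
  by rewrite /g => ->.
have cR : connected [set: R] by apply/connected_intervalP.
(* Since f is locally constant, all preimages are open, so the fibre through t is both open and
   closed in the connected line. *)
have oA (P : set M) : open (f @^-1` P).
  rewrite openE => r Pr; apply: filterS (loc r) => r' /= ->; exact: Pr.
have := cR [set r | f r = f t].
have E : [set r | f r = f t] = f @^-1` [set f t] by [].
move=> /(_ _ _ _)/[!E] H.
suff : setT `<=` f @^-1` [set f t] by move=> /(_ s I).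
rewrite -H //.
- by exists t.
- by exists (f @^-1` [set f t]); [exact: oA|rewrite setTI].
- exists (f @^-1` [set f t]); last by rewrite setTI.
  rewrite -[X in closed X]setCK; apply: open_closedC.
  by rewrite preimage_setC; exact: oA.
Qed.

End ZeroTangent.

(** * Logarithmic derivatives along the axes *)

Section PlaneLieGroup.
Context {R : realType} {n : nat} {G : lieGroupType R n}.
Local Open Scope group_scope.

(** Right translation by k(r) carries the logarithmic derivative at r to the tangent vector of k,
    which therefore vanishes too. *)
Lemma right_log_derivative_eq0_cst (k : R -> G) (s t : R) : smooth_into setT k ->
  (forall s, right_log_derivative k 1%R s = 0%R) -> k s = k t.
Proof.
move=> sk k0; apply: tangent_eq0_cst => // r.
have sr (a : G) : smooth_map setT (fun b : G => b * a).
  move=> c ac; apply: (@smooth_into_sub _ _ _ _ (crange c)); first by move=> x [].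
  apply: smooth_intoM; [exact: open_crange|exact: smooth_cinv|exact: smooth_into_cst].
have sk' := smooth_intoM openT sk (smooth_into_cst setT (k r)^-1).
rewrite (@tangent_ext _ _ _ _ _ ((fun b => b * k r) \o (fun r' => k r' * (k r)^-1))).
  rewrite (tangent_smooth_map (1%R : R) (sr (k r)) openT sk' I).
  rewrite -/(right_log_derivative k 1%R r) k0.
  by have [L _ ->] := differential_linear (k r * (k r)^-1) (sr (k r)); rewrite raddf0.
by move=> r' /=; rewrite -mulgA mulVg mulg1.
Qed.

Section Plane.
Context {u : R * R -> G} (su : smooth_into setT u).
Let oT := @openT (R * R)%type.

Lemma smooth_into_line_ex (y : R) : smooth_into setT (fun x => u (x, y)).
Proof.
apply: (smooth_into_comp coordinates_plane openT oT _ _ su) => // k.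
by apply: Ck_on_pair openT _ _; [exact: Ck_on_id|exact: Ck_on_cst].
Qed.

Lemma smooth_into_line_ey (x : R) : smooth_into setT (fun y => u (x, y)).
Proof.
apply: (smooth_into_comp coordinates_plane openT oT _ _ su) => // k.
by apply: Ck_on_pair openT _ _; [exact: Ck_on_cst|exact: Ck_on_id].
Qed.

Lemma right_log_derivative_ex_eq0_cst (x x' y : R) :
  (forall x, right_log_derivative u ex (x, y) = 0%R) -> u (x, y) = u (x', y).
Proof.
move=> u0; apply: (right_log_derivative_eq0_cst x x' (smooth_into_line_ex y)) => s.
rewrite -(u0 s); apply: tangent_line_eq; apply: filterE => r.
by rewrite line_ex [_ *: _]mulr1.
Qed.

Lemma right_log_derivative_ey_eq0_cst (x y y' : R) :
  (forall y, right_log_derivative u ey (x, y) = 0%R) -> u (x, y) = u (x, y').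
Proof.
move=> u0; apply: (right_log_derivative_eq0_cst y y' (smooth_into_line_ey x)) => s.
rewrite -(u0 s); apply: tangent_line_eq; apply: filterE => r.
by rewrite line_ey [_ *: _]mulr1.
Qed.

(** In [right_log_derivative_swap] the element u(x, y)^-1 is frozen at the base point, so its
    adjoint action is a fixed continuous linear map and comes out of the derivative. *)
Lemma is_derive_right_log_derivativeV (x y : R) :
  derivable (right_log_derivative u ex) (x, y) ey ->
  is_derive (x, y) ex (right_log_derivative (fun z => (u z)^-1) ey)
    (- Ad (u (x, y))^-1%g ('D_ey (right_log_derivative u ex) (x, y)))%R.
Proof.
move=> du; have [l [D1 D2]] := right_log_derivative_swap x y su.
apply: is_derive_eq D1 _.
have [L cL EL] := Ad_linear (u (x, y))^-1.
have [_ E] := is_derive_linear_comp cL du; rewrite EL -E.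
have [_ E2] := D2; apply: oppr_inj; rewrite opprK -E2.
by congr ('D_ey _ (x, y)); apply/funext => z; rewrite EL.
Qed.

(** On the horizontal line, u^-1 = u(x, y)^-1 c(s) with c(s) = u(x, y) u(s + x, y)^-1, a curve
    through 1 whose velocity is minus the logarithmic derivative of u. The fixed factor is linear
    and c is covered by [is_derive_Ad_comp]. *)
Lemma is_derive_AdV_comp (b : R * R -> 'rV[R]_n) (x y : R) :
  derivable b (x, y) ex ->
  is_derive (x, y) ex (fun z => Ad (u z)^-1 (b z))
    (Ad (u (x, y))^-1%g ('D_ex b (x, y)
       + lie_bracket G (- right_log_derivative u ex (x, y)) (b (x, y))))%R.
Proof.
move=> db; pose c (s : R) := u (x, y) * (u (s + x, y)%R)^-1.
have ss : smooth_into setT (fun s => u (s + x, y)%R).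
  apply: (smooth_into_comp coordinates_plane openT oT _ _ su) => // k.
  apply: Ck_on_pair openT _ _; last exact: Ck_on_cst.
  by apply: Ck_onD openT _ _; [exact: Ck_on_id|exact: Ck_on_cst].
have sc : smooth_into setT c.
  exact: (smooth_intoM openT (smooth_into_cst setT (u (x, y))) (smooth_intoV openT ss)).
have c0 : c 0%R = 1 by rewrite /c add0r mulgV.
have Tc : tangent c 0%R 1%R = (- right_log_derivative u ex (x, y))%R.
  have sr := smooth_intoM openT su (smooth_into_cst setT (u (x, y))^-1).
  rewrite /right_log_derivative -(tangentV1 ex oT sr I (mulgV _)).
  apply: tangent_line_eq; apply: filterE => s.
  by rewrite line_ex /c addr0 [_ *: _]mulr1 invgM invgK.
have db' : is_derive (0%R : R) (1%R : R) (fun s => b (s + x, y)%R) ('D_ex b (x, y)).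
  apply: is_derive_line_eq (derivableP db); apply: filterE => s.
  by rewrite line_ex addr0 [_ *: _]mulr1.
have := is_derive_Ad_comp openT sc I c0 (@ex_derive _ _ _ _ _ _ _ db').
have [_ ->] := db'; rewrite Tc add0r => D.
have [L cL EL] := Ad_linear (u (x, y))^-1; rewrite EL.
have [dD <-] := D.
apply: is_derive_line_eq (is_derive_linear_comp cL dD).
apply: filterE => s; rewrite line_ex addr0 [_ *: _]mulr1 -EL -AdM.
by rewrite /c mulgA mulVg mul1g.
Qed.

End Plane.

(** Applied to u^-1, the swap lemma differentiates the logarithmic derivative of (u^-1)^-1 = u. *)
Lemma derivable_right_log_derivative (u : R * R -> G) (x y : R) :
  smooth_into setT u -> derivable (right_log_derivative u ey) (x, y) ex.
Proof.
move=> su; have oT := @openT (R * R)%type.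
have [l [[D _] _]] := right_log_derivative_swap x y (smooth_intoV oT su).
move: D; have -> // : (fun z => (u z)^-1^-1) = u.
by apply/funext => z; rewrite invgK.
Qed.

End PlaneLieGroup.

(** * Pullbacks of forms *)

Section Pullback.
Context {R : realType} {n k : nat} {M : manifoldType R n}.
Context {th : M -> 'rV[R]_n -> 'rV[R]_k} (fth : is_form1 th).

Lemma pullback1_linear (V : normedModType R) (cV : coordinates V) (U : set V)
    (f : V -> M) (x : V) : open U -> smooth_into U f -> U x ->
  linear (pullback1 f th x).
Proof.
move=> oU sf Ux a u v; rewrite /pullback1.
have [L _ EL] := tangent_linear cV oU sf Ux.
by rewrite !EL linearP; exact: fth.1.
Qed.

Lemma pullback1_comp (V W : normedModType R) (cW : coordinates W) (U : set W)
    (f : W -> M) (s : V -> W) (z v : V) :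
  open U -> smooth_into U f -> U (s z) -> derivable s z v ->
  pullback1 (f \o s) th z v = pullback1 f th (s z) ('D_v s z).
Proof. by move=> oU sf Us ds; rewrite /pullback1 (tangent_comp cW oU sf Us ds). Qed.

Section Chart.
Context {c : chart R n M} (ac : atlas c).
Let A := pullback1 (cinv c) th.

Lemma pullback1_cinv_sum x v : crange c x ->
  A x v = \sum_(i : coord_idx (@coordinates_rV R n)) coord_fun i v *: A x (coord_vec i).
Proof.
move=> rx.
have lA := pullback1_linear (coordinates_rV n) (@open_crange _ _ _ c)
  (smooth_cinv ac) rx.
pose L : {linear 'rV[R]_n -> 'rV[R]_k} :=
  HB.pack (A x) (GRing.isLinear.Build _ _ _ _ _ lA).
rewrite -[A x v]/(L v) {1}(coord_sum (coordinates_rV n) v) raddf_sum.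
by apply: eq_bigr => i _; exact: (linearZZ L).
Qed.

Lemma derivable_pullback1_cinv x u v : crange c x -> derivable (fun y => A y v) x u.
Proof. by move=> rx; exact: (((fth.2 c v ac) 1%N).2 u).1. Qed.

Lemma derive_pullback1_cinv x u v : crange c x ->
  'D_u (fun y => A y v) x = \sum_(i : coord_idx (@coordinates_rV R n))
     coord_fun i v *: 'D_u (fun y => A y (coord_vec i)) x.
Proof.
move=> rx.
rewrite (@near_eq_derive _ _ _ _ (fun y => \sum_(i : coord_idx (@coordinates_rV R n))
  coord_fun i v *: A y (coord_vec i))).
  have [] // := @is_derive_bigsum R _ _ _ (index_enum (coord_idx (@coordinates_rV R n)))
    (fun i y => coord_fun i v *: A y (coord_vec i)) _ x u
    (fun i => is_deriveZ _ (derivableP (@derivable_pullback1_cinv x u (coord_vec i) rx))).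
have := open_nbhs_nbhs (conj (@open_crange _ _ _ c) rx).
by apply: filterS => y ry; exact: pullback1_cinv_sum.
Qed.

(** Smoothness of a form is given for constant vectors in a chart. Here both the base point and the
    vector move, so the vector is expanded in coordinates and the product rule is applied to each
    term. *)
Lemma is_derive_pullback1_cinv (V : normedModType R) (s b : V -> 'rV[R]_n)
    (z p : V) : crange c (s z) -> {for z, continuous s} ->
  derivable s z p -> derivable b z p ->
  is_derive z p (fun y => A (s y) (b y))
    (A (s z) ('D_p b z) + 'D_('D_p s z) (fun x => A x (b z)) (s z)).
Proof.
move=> rz cs ds db.
have cf (i : coord_idx (@coordinates_rV R n)) := @coord_fun_continuous _ _ _ i.
have dA (i : coord_idx (@coordinates_rV R n)) :
    differentiable (fun y => A y (coord_vec i)) (s z).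
  by move: (fth.2 c (coord_vec (c := coordinates_rV n) i) ac 1%N) => CA;
     exact: (C1_differentiable (coordinates_rV n) (coordinates_rV k)
       (@open_crange _ _ _ c) CA rz).
have D i := is_derive_scale
  (@ex_derive _ _ _ _ _ _ _ (is_derive_linear_comp (cf i) db))
  (@ex_derive _ _ _ _ _ _ _ (is_derive_comp ds (dA i))).
have Ds := is_derive_bigsum (index_enum (coord_idx (@coordinates_rV R n))) D.
apply: near_eq_is_derive; last first.
  apply: is_derive_eq Ds _.
  rewrite pullback1_cinv_sum// derive_pullback1_cinv// -big_split /=.
  apply: eq_bigr => i _.
  have [_ ->] := is_derive_linear_comp (cf i) db.
  by have [_ ->] := is_derive_comp ds (dA i).
have : \forall y \near z, crange c (s y).
  by apply: cs; apply: open_nbhs_nbhs; split => //; exact: open_crange.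
by apply: filterS => y ry; rewrite /= [RHS]pullback1_cinv_sum.
Qed.

End Chart.

(** The pullback does not depend on charts, so near z it can be computed throughout in the chart at
    f z, as the pullback of the local expression of the form. *)
Lemma is_derive_pullback1 (V : normedModType R) (f : V -> M) (z p q : V) :
  let c := chart_at (f z) in
  smooth_into setT f ->
  is_derive z p (fun y => pullback1 f th y q)
    (pullback1 (cinv c) th (cmap c (f z)) ('D_p (fun y => 'D_q (cmap c \o f) y) z)
     + 'D_(tangent f z p) (fun x => pullback1 (cinv c) th x (tangent f z q))
        (cmap c (f z))).
Proof.
move=> c sf; have [N [oN Nz NU sN]] := smooth_into_chart openT sf (I : setT z).
rewrite -/c in NU sN.
have ac : atlas c by exact: chart_at_atlas.
have rz : crange c (cmap c (f z)) by exact/crange_cmap/chart_at_cdom.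
have D := @is_derive_pullback1_cinv c ac V (cmap c \o f)
  (fun y => 'D_q (cmap c \o f) y) z p rz ((sN 0%N).1 z Nz)
  (((sN 1%N).2 p).1 z Nz) ((((sN 2%N).2 q).2.2 p).1 z Nz).
apply: near_eq_is_derive D.
have := open_nbhs_nbhs (conj oN Nz); apply: filterS => y Ny.
have [_ cy] := NU _ Ny.
rewrite -(pullback1_comp (coordinates_rV n) (@open_crange _ _ _ c)
  (smooth_cinv ac) (crange_cmap cy) (((sN 1%N).2 q).1 y Ny)).
rewrite /pullback1 /= cmapK//; congr (th _ _).
apply: tangent_near_eq; have := open_nbhs_nbhs (conj oN Ny).
by apply: filterS => x /NU[_ cx]; rewrite /= cmapK.
Qed.

(** Naturality of d: the terms with second derivatives of f are symmetric in p and q and cancel. *)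
Lemma ext_der1_pullback (V : normedModType R) (f : V -> M) (z p q : V) :
  smooth_into setT f ->
  'D_p (fun y => pullback1 f th y q) z - 'D_q (fun y => pullback1 f th y p) z =
  ext_der1 th (f z) (tangent f z p) (tangent f z q).
Proof.
move=> sf; have [N [oN Nz NU sN]] := smooth_into_chart openT sf (I : setT z).
have [_ ->] := is_derive_pullback1 z p q sf.
have [_ ->] := is_derive_pullback1 z q p sf.
rewrite (schwarz_rV q p oN (sN 2%N) Nz) /ext_der1.
by rewrite opprD addrACA subrr add0r.
Qed.

End Pullback.

(** * Surface transport *)

Section CrossedModules.
Context {R : realType}.

Lemma differential_comp (l m n : nat) (L : manifoldType R l)
    (M : manifoldType R m) (N : manifoldType R n) (F : M -> N) (F' : L -> M)
    (p : L) (v : 'rV[R]_l) : smooth_map setT F -> smooth_map setT F' ->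
  differential (F \o F') p v = differential F (F' p) (differential F' p v).
Proof.
move=> sF sF'; have cp := chart_at_cdom p.
have sf : smooth_into (crange (chart_at p)) (F' \o cinv (chart_at p)).
  by apply: smooth_into_sub (sF' _ (chart_at_atlas p)) => x.
have := tangent_smooth_map v sF (@open_crange _ _ _ (chart_at p)) sf (crange_cmap cp).
by rewrite /= cmapK.
Qed.

Section OneCrossedModule.
Context {nG nH : nat} {G : lieGroupType R nG} {H : lieGroupType R nH}.
Context {t : H -> G} {m : G -> H -> H} (crossed : lie_crossed_module t m).
Local Open Scope group_scope.

Lemma crossed_t1 : t 1 = 1.
Proof.
by apply: (mulgI (t 1)); rewrite -(lcm_tM crossed) !mulg1.
Qed.

Lemma crossed_tV A : t A^-1 = (t A)^-1.
Proof.
by apply: (mulgI (t A)); rewrite -(lcm_tM crossed) !mulgV crossed_t1.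
Qed.

Lemma crossed_m1r a : m a 1 = 1.
Proof.
by apply: (mulgI (m a 1)); rewrite -(lcm_m_aut crossed) !mulg1.
Qed.

Lemma smooth_crossed_m a : smooth_map setT (m a).
Proof.
move=> c ac; apply: (@smooth_into_sub _ _ _ _ (crange c)); first by move=> x [].
exact: (smooth_map2_comp (@open_crange _ _ _ c) (smooth_into_cst _ a)
  (smooth_cinv ac) (lcm_m_smooth crossed)).
Qed.

(** Differentiate the equivariance t(m(a)(A)) = a t(A) a^-1 at A = 1. *)
Lemma tdot_mdot a X : tdot t (mdot m a X) = Ad a (tdot t X).
Proof.
rewrite /tdot /mdot /Ad; have st := lcm_t_smooth crossed.
have := differential_comp 1 X st (smooth_crossed_m a).
rewrite crossed_m1r => <-.
have := differential_comp 1 X (smooth_conj a) st.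
rewrite crossed_t1 => <-.
have -> // : t \o m a = (fun b => a * b * a^-1) \o t.
by apply/funext => A; exact: (lcm_equivariance crossed).
Qed.

Lemma right_log_derivative_hom (V : normedModType R) (U : set V) (f : V -> H)
    (v z : V) : open U -> smooth_into U f -> U z ->
  right_log_derivative (fun x => t (f x)) v z =
  tdot t (right_log_derivative f v z).
Proof.
move=> oU sf Uz.
have sr := smooth_intoM oU sf (smooth_into_cst U (f z)^-1).
have := tangent_smooth_map v (lcm_t_smooth crossed) oU sr Uz.
rewrite mulgV /tdot /right_log_derivative => <-; apply: tangent_ext => x /=.
by rewrite (lcm_tM crossed) crossed_tV.
Qed.

End OneCrossedModule.
End CrossedModules.

(** * Transport along a surface with constant sides *)

Section Transport.
Context {R : realType} {nG nH : nat} {G : lieGroupType R nG}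
  {H : lieGroupType R nH} {t : H -> G} {m : G -> H -> H}
  (crossed : lie_crossed_module t m).
Context {n : nat} {M : manifoldType R n} {th : M -> 'rV[R]_n -> 'rV[R]_nG}
  {Ups : M -> 'rV[R]_n -> 'rV[R]_n -> 'rV[R]_nH}
  (doublet : connection_doublet t th Ups).

Lemma derive_ex_eq0_cst (k : nat) (f : R * R -> 'rV[R]_k) (x x' y : R) :
  (forall x, is_derive (x, y) ex f 0) -> f (x, y) = f (x', y).
Proof.
move=> f0.
have cf (i : coord_idx (@coordinates_rV R k)) := @coord_fun_continuous _ _ _ i.
rewrite [LHS](coord_sum (coordinates_rV k)) [RHS](coord_sum (coordinates_rV k)).
apply: eq_bigr => i _.
pose g (z : R * R) : R := coord_fun i (f z).
have Dg r : is_derive (r, y) ex g 0.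
  have [df f0'] := f0 r; apply: is_derive_eq (is_derive_linear_comp (cf i) df) _.
  by rewrite f0' raddf0.
have E r : (x', y) + r *: ex = (r + x', y) by rewrite addrC line_ex.
have [|r _] := @MVT_line R (R * R)%type g (x', y) ex (x - x').
  by move=> r _; rewrite E; have [] := Dg (r + x').
rewrite !E subrK; have [_ ->] := Dg (r + x').
by rewrite mulr0 => /eqP; rewrite subr_eq0 => /eqP; rewrite /g => ->.
Qed.

(** Vanishing fake curvature along f. The factor 1/2 disappears because antisymmetry of the bracket
    makes the two terms of [theta, theta] equal. *)
Lemma curvature (V : normedModType R) (f : V -> M) (z p q : V) :
  smooth_into setT f ->
  'D_p (fun y => pullback1 f th y q) z - 'D_q (fun y => pullback1 f th y p) z
  + lie_bracket G (pullback1 f th z p) (pullback1 f th z q) =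
  tdot t (pullback2 f Ups z p q).
Proof.
move=> sf; have [fth _ curv] := doublet.
rewrite (ext_der1_pullback fth z p q sf).
have /eqP := curv (f z) (tangent f z p) (tangent f z q).
rewrite subr_eq0 => /eqP <-; congr (_ + _).
rewrite /bracket_form.
rewrite (lie_bracketC (th (f z) (tangent f z q)) (th (f z) (tangent f z p))) opprK.
have half (w : 'rV[R]_nG) : 2^-1 *: (w + w) = w.
  by rewrite -mulr2n -(scaler_nat 2 w) scalerA mulVf ?scale1r// pnatr_eq0.
exact/esym/half.
Qed.

Lemma transport_trivial_boundary (Sig : R * R -> M) (p0 p1 q0 q1 : M) (h : H) :
  smooth_into setT Sig ->
  (forall y, Sig (0, y) = p0) -> (forall y, Sig (1, y) = p1) ->
  (forall x, Sig (x, 0) = q0) -> (forall x, Sig (x, 1) = q1) ->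
  is_transport m th Ups Sig h -> t h = 1%g.
Proof.
move=> sS S0y S1y Sx0 Sx1 [u [v [E [[su sv sE] [Du u1] [Dv v0] [DE E1] ->]]]].
have [fth _ _] := doublet; have oT := @openT (R * R)%type.
have th0 p : th p 0 = 0.
  by have := fth.1 p (- 1) 0 0; rewrite scaler0 addr0 scaleN1r addNr.
pose a z := pullback1 Sig th z ex; pose b z := pullback1 Sig th z ey.
(* A form vanishes on the tangent vectors along a line on which the surface is constant. *)
have pull0 z w : (forall s : R, Sig (s *: w + z) = Sig z) -> pullback1 Sig th z w = 0.
  move=> Sc; rewrite /pullback1 (@tangent_line_eq _ _ _ _ _ Sig (fun=> Sig z) z w z w).
    by rewrite tangent_cst th0.
  exact: filterE.
have b1 y : b (1, y) = 0 by apply: pull0 => s; rewrite line_ey !S1y.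
have b0 y : b (0, y) = 0 by apply: pull0 => s; rewrite line_ey !S0y.
have a0 x : a (x, 0) = 0 by apply: pull0 => s; rewrite line_ex !Sx0.
have a1 x : a (x, 1) = 0 by apply: pull0 => s; rewrite line_ex !Sx1.
(* This removes v from the equation of E, where it occurs only on the side x = 1. *)
have v1 y : v (1, y) = 1%g.
  rewrite -(v0 1); apply: right_log_derivative_ey_eq0_cst => // y'.
  by rewrite Dv -/(b _) b1 oppr0.
have u0 : u (0, 0) = 1%g.
  rewrite -(u1 0); apply: right_log_derivative_ex_eq0_cst => // x.
  by rewrite Du -/(a _) a0 oppr0.
have u01 : u (0, 1) = 1%g.
  rewrite -(u1 1); apply: right_log_derivative_ex_eq0_cst => // x.
  by rewrite Du -/(a _) a1 oppr0.
pose w z := ((u z)^-1)%g; pose tE z := t (E z).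
have stE : smooth_into setT tE := smooth_map_comp oT sE (lcm_t_smooth crossed).
have Du' : right_log_derivative u ex = fun z => - a z by apply/funext => z.
have da x y : derivable a (x, y) ey.
  by have [] := is_derive_pullback1 fth (x, y) ey ex sS.
have db x y : derivable b (x, y) ex.
  by have [] := is_derive_pullback1 fth (x, y) ex ey sS.
have DtE x y : is_derive (x, y) ex (right_log_derivative tE ey)
    (- Ad (w (x, y)) (tdot t (pullback2 Sig Ups (x, y) ex ey))).
  have [L cL EL] := differential_linear (1%g : H) (lcm_t_smooth crossed).
  have -> : right_log_derivative tE ey = fun z => L (right_log_derivative E ey z).
    apply/funext => z; rewrite -EL.
    exact: (right_log_derivative_hom crossed ey oT sE I).
  have dE := @derivable_right_log_derivative _ _ _ E x y sE.
  apply: is_derive_eq (is_derive_linear_comp cL dE) _.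
  have EN X : L (- X) = - tdot t X by rewrite /tdot EL raddfN.
  by rewrite DE v1 invg1 mul1g EN (tdot_mdot crossed).
have Dw x y : is_derive (x, y) ex (right_log_derivative w ey)
    (Ad (w (x, y)) ('D_ey a (x, y))).
  have dra : derivable (right_log_derivative u ex) (x, y) ey.
    by rewrite Du'; exact: derivableN.
  apply: is_derive_eq (is_derive_right_log_derivativeV su dra) _.
  have [L _ EL] := Ad_linear (w (x, y)).
  have -> : 'D_ey (right_log_derivative u ex) (x, y) = - 'D_ey a (x, y).
    by rewrite Du'; exact: (deriveN (da x y)).
  by rewrite -[((u _)^-1)%g]/(w _) !EL raddfN opprK.
have Db x y : is_derive (x, y) ex (fun z => Ad (w z) (b z))
    (Ad (w (x, y)) ('D_ex b (x, y) + lie_bracket G (a (x, y)) (b (x, y)))).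
  apply: is_derive_eq (is_derive_AdV_comp su (db x y)) _.
  by rewrite Du' opprK.
pose K z := right_log_derivative tE ey z - right_log_derivative w ey z
  + Ad (w z) (b z).
have DK x y : is_derive (x, y) ex K 0.
  apply: is_derive_eq (is_deriveD (is_deriveB (DtE x y) (Dw x y)) (Db x y)) _.
  have cancel X Y Z : - Ad (w (x, y)) (X - Y + Z) - Ad (w (x, y)) Y
      + Ad (w (x, y)) (X + Z) = 0.
    have [L _ EL] := Ad_linear (w (x, y)).
    rewrite !EL -raddfN -raddfB -raddfD -[RHS](raddf0 L); congr (L _).
    by apply/rowP => i; rewrite !mxE; ring.
  have <- : 'D_ex b (x, y) - 'D_ey a (x, y) + lie_bracket G (a (x, y)) (b (x, y)) =
      tdot t (pullback2 Sig Ups (x, y) ex ey) := curvature (x, y) ex ey sS.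
  exact: cancel.
have rld0 (f : R * R -> G) (x y : R) (g : G) : (forall y, f (x, y) = g) ->
    right_log_derivative f ey (x, y) = 0.
  move=> fg; rewrite -(right_log_derivative_cst g (x, y) ey).
  by apply: tangent_line_eq; apply: filterE => s; rewrite line_ey !fg.
have K1 y : K (1, y) = 0.
  have [L _ EL] := Ad_linear (w (1, y)).
  rewrite /K b1 EL raddf0 addr0 (@rld0 tE 1 y 1%g); last first.
    by move=> y'; rewrite /tE (E1 0 y').1 (crossed_t1 crossed).
  rewrite (@rld0 w 1 y 1%g) ?subrr// => y'.
  by rewrite /w u1 invg1.
have K0 y : right_log_derivative tE ey (0, y) = right_log_derivative w ey (0, y).
  have := K1 y; rewrite -(derive_ex_eq0_cst 0 1 (fun x => DK x y)) /K b0.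
  have [L _ EL] := Ad_linear (w (0, y)).
  by rewrite EL raddf0 addr0 => /eqP; rewrite subr_eq0 => /eqP.
pose k z := (u z * tE z)%g.
have sk : smooth_into setT k := smooth_intoM oT su stE.
(* By the product rule, replacing t(E) by w = u^-1 does not change the logarithmic derivative of the
   product with u, and u u^-1 is constant. *)
have Dk y : right_log_derivative k ey (0, y) = 0.
  rewrite (right_log_derivativeM ey oT su stE I) K0.
  rewrite -(right_log_derivativeM ey oT su (smooth_intoV oT su) I).
  have -> : (fun z => u z * (u z)^-1)%g = fun=> 1%g.
    by apply/funext => z; rewrite mulgV.
  exact: right_log_derivative_cst.
have := right_log_derivative_ey_eq0_cst sk 1 0 Dk.
by rewrite /k /tE u0 u01 !mul1g (E1 0 0).2 (crossed_t1 crossed).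
Qed.

End Transport.

(** * The normalized surface of a knot *)

Section NormalizedSurface.
Context {R : realType}.

(** Inversion and composition only reparametrize: every value of the word is a value of a letter, or
    the base point for the empty word. *)
Lemma commutator_word_ind (T : Type) (P : T -> Prop) (p : T) (l : nat)
    (a : 'I_l + 'I_l -> R -> T) (x : R) :
  P p -> (forall i y, P (a i y)) -> P (commutator_word p a x).
Proof.
move=> Pp Pa.
pose allP := foldr (fun (g : R -> T) Q => (forall y, P (g y)) /\ Q) True.
have prod s y : allP s -> P (curve_prod p s y).
  case: s => [//|g s] [Pg] /=.
  elim: s g Pg => [//|h s IH] g Pg [Ph Ps] /=.
  by apply: IH Ps => z; rewrite /curve_comp; case: ifP.
apply: prod; rewrite /commutator_word; elim: (enum _) => [//|r rs IH] /=.
by split; [|split; [|split; [|split]]] => // y; exact: Pa.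
Qed.

Context {n : nat} {S : manifoldType R 2} {M : manifoldType R n}.

(** Only the seam y = 1/2 is in question. Near its upper side [Sig] no longer depends on y, and the
    two maps agree on g1, so each of the two formulas remains valid a little beyond the seam. *)
Lemma smooth_normalized_surface (p0 p1 : S) (g0 g1 : R -> S) (Sig : R * R -> S)
    (Xi XiM : S -> M) :
  is_surface p0 p1 g0 g1 Sig -> smooth_map setT Xi -> smooth_map setT XiM ->
  (forall x, Xi (g1 x) = XiM (g1 x)) ->
  smooth_into setT (normalized_surface Sig XiM Xi).
Proof.
move=> [_ _ sS [e [/andP[e0 _] [_ _ _ S1]]]] sXi sXiM Eg.
have oT := @openT (R * R)%type.
(* Both halves have this form, with (c, d) = (2, 0) for the knot and (-2, 2) for the reversed
   reference surface. *)
have affine (F : S -> M) (c d : R) : smooth_map setT F ->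
    smooth_into setT (fun z : R * R => F (Sig (z.1, c * z.2 + d))).
  move=> sF; apply: (smooth_map_comp oT _ sF).
  apply: (smooth_into_comp coordinates_plane oT oT _ _ sS) => // k.
  apply: (Ck_on_pair oT); first exact: Ck_on_fst.
  apply: (Ck_onD oT _ (Ck_on_cst _ _ _)).
  exact: (Ck_on_scale oT (Ck_on_cst k _ c) (@Ck_on_snd R k _)).
have E z : 1 - e < 2 * z.2 < 1 + e ->
    Xi (Sig (z.1, 2 * z.2 + 0)) = XiM (Sig (z.1, - 2 * z.2 + 2)).
  move=> /andP[H1 H2]; rewrite !S1 ?Eg//; lra.
have osnd (c : R) : open [set z : R * R | z.2 < c] /\ open [set z : R * R | c < z.2].
  split.
    exact: (open_comp (fun z _ => @cvg_snd _ _ _ _ _) (@open_lt R c)).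
  exact: (open_comp (fun z _ => @cvg_snd _ _ _ _ _) (@open_gt R c)).
apply: smooth_into_local => z _.
(* The half planes y < (1 + e) / 2 and y > (1 - e) / 2 cover the plane, and their intersection is
   the strip on which the two formulas coincide. *)
have [zlt|zge] := ltP z.2 ((1 + e) / 2).
- exists [set z : R * R | z.2 < (1 + e) / 2], (fun z => Xi (Sig (z.1, 2 * z.2 + 0))).
  split => //; first exact: (osnd _).1.
    exact: smooth_into_sub (affine Xi 2 0 sXi).
  move=> y /= ylt; rewrite /normalized_surface /surface_comp /surface_inv /=.
  case: ifPn => [_|]; first by rewrite addr0.
  rewrite -ltNge => ygt; rewrite E; last by lra.
  by congr (XiM (Sig (_, _))); ring.
- exists [set z : R * R | (1 - e) / 2 < z.2], (fun z => XiM (Sig (z.1, - 2 * z.2 + 2))).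
  split => /=; [exact: (osnd _).2|lra| |].
    exact: smooth_into_sub (affine XiM (- 2) 2 sXiM).
  move=> y /= ygt; rewrite /normalized_surface /surface_comp /surface_inv /=.
  case: ifPn => [yle|_]; last by congr (XiM (Sig (_, _))); ring.
  by rewrite -E ?addr0//; lra.
Qed.

End NormalizedSurface.

Theorem proposition3p3p6 (R : realType)
  (nG nH : nat) (G : lieGroupType R nG) (H : lieGroupType R nH)
  (t : H -> G) (m : G -> H -> H) (crossed : lie_crossed_module t m)
  (C : manifoldType R 1) (OC : set (chart R 1 C)) (pC : C)
  (circleC : oriented_circle OC pC)
  (S : manifoldType R 2) (OS : set (chart R 2 S)) (l : nat)
  (surfaceS : closed_surface OS l)
  (pS : S) (zS : 'I_l + 'I_l -> C -> S)
  (markingS : surface_marking OC pC OS pS zS)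
  (gC : R -> C) (compatC : compatible_curve OC pC gC)
  (SigS : R * R -> S) (compatS : compatible_surface OS pS zS gC SigS)
  (n : nat) (M : manifoldType R n) (pM : M) (zM : 'I_l + 'I_l -> C -> M)
  (markingM : manifold_marking pC pM zM)
  (XiM : S -> M) (referenceM : surface_knot pS zS pM zM XiM)
  (th : M -> 'rV[R]_n -> 'rV[R]_nG)
  (Ups : M -> 'rV[R]_n -> 'rV[R]_n -> 'rV[R]_nH)
  (doublet : connection_doublet t th Ups) (flat : flat_doublet m th Ups)
  (Xi : S -> M) (knotXi : surface_knot pS zS pM zM Xi)
  (F : H) (holonomyF : is_2holonomy m th Ups SigS XiM Xi F) :
  t F = 1%g.
Proof.
have [surfS _ _ _] := compatS.
have [[sXi _ _] XipS XizS] := knotXi; have [[sXiM _ _] XiMpS XiMzS] := referenceM.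
(* Both knots carry the marking of S to that of M, hence agree along [tau_S], where the two surfaces
   are glued. *)
have Etau x : Xi (commutator_word pS (fun i => zS i \o gC) x) =
    XiM (commutator_word pS (fun i => zS i \o gC) x).
  apply: (@commutator_word_ind _ _ (fun q => Xi q = XiM q)) => [|i y].
    by rewrite XipS XiMpS.
  by rewrite -[LHS]/((Xi \o zS i) (gC y)) -[RHS]/((XiM \o zS i) (gC y)) XizS XiMzS.
have sSig := smooth_normalized_surface surfS sXi sXiM Etau.
have [_ _ _ [e [/andP[e0 e1] [S0 S1 Sy0 _]]]] := surfS.
apply: (transport_trivial_boundary crossed doublet (p0 := pM) (p1 := pM)
  (q0 := pM) (q1 := pM) sSig _ _ _ _ holonomyF) => x;
  rewrite /normalized_surface /surface_comp /surface_inv /=.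
- by case: ifP => _; rewrite S0.
- by case: ifP => _; rewrite S1//; lra.
- by rewrite ifT ?Sy0//; lra.
(* At y = 1 the reversed reference surface is read on its own bottom side, which is constant;
   [tau_S] appears only on the seam. *)
- by rewrite ifF ?Sy0//; lra.
Qed.
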